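(* Let $(R,\mathfrak m,K)$ be an F-finite local ring of prime characteristic $p>0$ and Krull dimension $d$, and let $M$ be any finitely generated $R$-module of Krull dimension $d$. Then the sequence $\{F^n_*(M)\}_n$ is a lim Cohen-Macaulay sequence of $R$-modules. Hence, if $S$ is any ring module-finite over $R$ of the same Krull dimension as $R$, then $\{F^n_*(S)\}_n$ is a lim Cohen-Macaulay sequence of $R$-algebras. In particular, $\{F^n_*(R)\}_n$ is a lim Cohen-Macaulay sequence of $R$-algebras.
   Context: All rings are commutative with identity; a local ring $(R,\mathfrak m,K)$ is Noetherian with unique maximal ideal $\mathfrak m$ and residue field $K$. A ring of characteristic $p$ is F-finite if its Frobenius endomorphism is module-finite. $F^n_*(M)$ denotes the $R$-module obtained from $M$ by restriction of scalars along the $n$-fold Frobenius $F^n:R\to R$, $r\mapsto r^{p^n}$. $\ell$ is length, $\nu(M)=\dim_K(K\otimes_R M)$ is the least number of generators of $M$, and $H_i(\underline x;M)$ is Koszul homology. A sequence $\{M_n\}_n$ of nonzero finitely generated modules over a local ring $R$ of Krull dimension $d$ is lim Cohen-Macaulay if for some (equivalently, every) system of parameters $\underline x=x_1,\dots,x_d$ of $R$, $\ell(H_i(\underline x;M_n))=\mathrm o(\nu(M_n))$ as $n\to\infty$ for all $i\ge 1$. If moreover each $M_n$ is a module-finite $R$-algebra, it is called a lim Cohen-Macaulay sequence of $R$-algebras. *)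

(* Defs.v *)
From HB Require Import structures.
From mathcomp Require Import all_boot all_order all_algebra.
From mathcomp Require Import all_classical topology normedtype landau.

Set Implicit Arguments.
Unset Strict Implicit.
Unset Printing Implicit Defensive.
Import Order.TTheory GRing.Theory Num.Theory.
Import numFieldNormedType.Exports.
Local Open Scope classical_set_scope.
Local Open Scope ring_scope.

Section Modules.
Variables (R : comNzRingType) (V : lmodType R).

Definition submodule (N : set V) : Prop := GRing.submod_closed [in N].

Definition lin_span n (e : 'I_n -> V) : set V :=
  [set v | exists c : 'I_n -> R, v = \sum_(i < n) c i *: e i].

Definition generated_by n : Prop := exists e : 'I_n -> V, lin_span e = setT.

Definition fin_gen : Prop := exists n, generated_by n.

(* The least number of generators; 0 (junk) if V is not finitely generated. *)
Definition nu : nat :=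
  if pselect (exists n, `[< generated_by n >]) is left h then ex_minn h else 0%N.

(* The length of the subquotient N / L is l: there is a chain of submodules
   L = C 0 < C 1 < ... < C l = N that cannot be refined, i.e. a composition
   series of N / L of length l. *)
Definition subquot_length (L N : set V) (l : nat) : Prop :=
  exists C : nat -> set V,
    [/\ C 0%N = L, C l = N, forall i, (i <= l)%N -> submodule (C i)
      & forall i, (i < l)%N -> C i `<` C i.+1 /\
          forall D, submodule D -> ~ (C i `<` D /\ D `<` C i.+1)].

Definition annihilator : set R := [set a | forall v : V, a *: v = 0].

End Modules.

Arguments nu {R} V.
Arguments fin_gen {R} V.
Arguments annihilator {R} V.

Section Rings.
Variable R : comNzRingType.

Definition ideal (I : set R) : Prop := submodule (I : set R^o).

Definition gen_ideal n (x : 'I_n -> R) : set R := lin_span (x : 'I_n -> R^o).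

Definition noetherian : Prop :=
  forall I, ideal I -> exists n (x : 'I_n -> R), I = gen_ideal x.

Definition maximal_ideal (m : set R) : Prop :=
  [/\ ideal m, m <> setT & forall I, ideal I -> m `<=` I -> I = m \/ I = setT].

Definition local_ring (m : set R) : Prop :=
  [/\ noetherian, maximal_ideal m & forall n, maximal_ideal n -> n = m].

Definition prime_ideal (P : set R) : Prop :=
  [/\ ideal P, P <> setT & prime_idealr_closed [in P]].

(* P 0 < P 1 < ... < P n are prime ideals containing I. *)
Definition prime_chain (I : set R) n (P : nat -> set R) : Prop :=
  (forall i, (i <= n)%N -> prime_ideal (P i) /\ I `<=` P i) /\
  (forall i, (i < n)%N -> P i `<` P i.+1).

(* The Krull dimension of R / I is d. *)
Definition quot_krull_dim (I : set R) (d : nat) : Prop :=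
  (exists P, prime_chain I d P) /\
  (forall n P, prime_chain I n P -> (n <= d)%N).

Definition ring_krull_dim (d : nat) : Prop := quot_krull_dim [set 0] d.

Definition mod_krull_dim (M : lmodType R) (d : nat) : Prop :=
  quot_krull_dim (annihilator M) d.

Definition is_sop (m : set R) d (x : 'I_d -> R) : Prop :=
  [/\ ring_krull_dim d, forall i, m (x i)
    & forall r, m r -> exists k, gen_ideal x (r ^+ k)].

End Rings.

Arguments noetherian R : clear implicits.
Arguments ring_krull_dim R d : clear implicits.

Section Koszul.
Variables (R : comNzRingType) (d : nat) (x : 'I_d -> R) (M : lmodType R).

(* A chain f stands for the element \sum_J e_J (x) f J of the exterior algebra
   of R^d tensored with M, where e_J is the wedge of the e_j, j in J, in
   increasing order; it has degree i if only the J of cardinal i occur. *)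
Definition koszul_deg i : set {ffun {set 'I_d} -> M} :=
  [set f | forall J : {set 'I_d}, #|J| != i -> f J = 0].

(* The boundary sends e_J (x) v to the sum over k in J of
   (-1) ^ #{j in J | j < k} e_(J \ k) (x) (x_k v). *)
Definition koszul_d (f : {ffun {set 'I_d} -> M}) : {ffun {set 'I_d} -> M} :=
  [ffun J : {set 'I_d} => \sum_(k < d | k \notin J)
     ((-1) ^+ #|[set j in J | (j < k)%N]| * x k) *: f (k |: J)].

Definition koszul_cycles i : set {ffun {set 'I_d} -> M} :=
  [set f | koszul_deg i f /\ koszul_d f = 0].

Definition koszul_boundaries i : set {ffun {set 'I_d} -> M} :=
  koszul_d @` koszul_deg i.+1.

Definition koszul_homology_length i (l : nat) : Prop :=
  subquot_length (koszul_boundaries i) (koszul_cycles i) l.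

End Koszul.

Section LimCM.
Variables (R : comNzRingType) (m : set R).

Definition lim_CM (M : nat -> lmodType R) : Prop :=
  (forall n, fin_gen (M n) /\ exists v : M n, v <> 0) /\
  exists d (x : 'I_d -> R), is_sop m x /\
    forall i, (0 < i)%N -> exists l : nat -> nat,
      (forall n, koszul_homology_length x (M n) i (l n)) /\
      (fun n => (l n)%:R : rat^o) =o_\oo (fun n => (nu (M n))%:R : rat^o).

(* Module-finiteness of each A n over R is part of lim_CM. *)
Definition lim_CM_algebras (A : nat -> comAlgType R) : Prop :=
  lim_CM (fun n => A n : lmodType R).

End LimCM.

Section FrobeniusPushforward.
Variables (R : comNzRingType) (p : nat) (chR : p \in [pchar R]).

Lemma frobD n (a b : R) :
  (a + b) ^+ (p ^ n) = a ^+ (p ^ n) + b ^+ (p ^ n).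
Proof.
elim: n => [|n IH]; first by rewrite !expr1.
by rewrite expnSr !exprM IH -!(pFrobenius_autE chR)
  (pFrobenius_autD_comm chR (mulrC _ _)).
Qed.

(* F^n_* M. The proof chR is recorded in the type because the module structure
   below exists only in characteristic p. *)
Definition frob_push (n : nat) (M : Type) : Type := let _ := chR in M.

HB.instance Definition _ n (M : lmodType R) :=
  GRing.Zmodule.copy (frob_push n M) M.

Section Module.
Variables (n : nat) (M : lmodType R).
Let fscale (a : R) (v : frob_push n M) : frob_push n M :=
  a ^+ (p ^ n) *: (v : M).

Let fscaleA a b v : fscale a (fscale b v) = fscale (a * b) v.
Proof. by rewrite /fscale scalerA exprMn. Qed.

Let fscale1 : left_id 1 fscale.
Proof. by move=> v; rewrite /fscale expr1n scale1r. Qed.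

Let fscaleDr : right_distributive fscale +%R.
Proof. by move=> a u v; rewrite /fscale scalerDr. Qed.

Let fscaleDl v : {morph fscale^~ v : a b / a + b}.
Proof. by move=> a b; rewrite /fscale frobD scalerDl. Qed.

HB.instance Definition _ := GRing.Zmodule_isLmodule.Build R (frob_push n M)
  fscaleA fscale1 fscaleDr fscaleDl.

Lemma frob_scaleE (a : R) (v : frob_push n M) :
  a *: v = (a ^+ (p ^ n) *: (v : M) : M).
Proof. by []. Qed.
End Module.

Section Algebra.
Variables (n : nat) (S : comAlgType R).
HB.instance Definition _ := GRing.ComNzRing.copy (frob_push n S) S.

Let fscalerAl (a : R) (u v : frob_push n S) : a *: (u * v) = (a *: u) * v.
Proof. by rewrite !frob_scaleE; exact: (@scalerAl R S). Qed.

HB.instance Definition _ :=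
  GRing.Lmodule_isLalgebra.Build R (frob_push n S) fscalerAl.

Let fscalerAr (a : R) (u v : frob_push n S) : a *: (u * v) = u * (a *: v).
Proof. by rewrite !frob_scaleE; exact: (@scalerAr R S). Qed.

HB.instance Definition _ :=
  GRing.Lalgebra_isAlgebra.Build R (frob_push n S) fscalerAr.
End Algebra.

Definition F_finite : Prop := fin_gen (frob_push 1 R^o : lmodType R).

End FrobeniusPushforward.

(* Main.v *)
(* Write q = p ^ n. The Koszul homology of x on F^n_* M is that of x ^ q on M,
   and passing to F^n_* multiplies lengths over R by a_n, the length of F^n_* K.
   Since F^n_* M / x F^n_* M has length at most nu (F^n_* M) times that of
   R / (x), it suffices to show that H_i(x ^ q; M) has length O(q ^ (d - 1)) for
   i > 0, while M / x ^ q M has length at least c q ^ d with c > 0.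

   Upper bound, for any x with M / x M of finite length, by induction on the
   number of elements of x. Filtering by the x_1-power torsion of M reduces to
   two cases. If x_1 kills M, then H_i(x ^ q; M) is bounded by H_i and H_(i-1)
   of the remaining elements. If x_1 is M-regular, then H_i(x ^ q; M) is H_i of
   the remaining elements on M / x_1 ^ q M, which is filtered by q copies of
   M / x_1 M.

   Lower bound. Take a chain P_0 < ... < P_d of primes in the support of M. By
   prime avoidance one can choose the system of parameters with x_i in P_i but
   not in P_(i-1), so that no dimension theory is needed to see that
   dim R / (P_0 + x_1 R) is still at least d - 1. Filtering R / (P_0 + x_1 ^ q R)
   by q copies of R / (P_0 + x_1 R) and controlling the error by H_1 gives the
   bound for R / P_0 by induction. Finally some cyclic submodule of M maps onto
   R / P_0, and H_1 again bounds the loss. *)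
Require Import Defs.
From mathcomp Require Import all_boot all_order all_algebra.
From mathcomp Require Import all_classical topology normedtype landau.
From mathcomp Require Import zify.
Set Implicit Arguments.
Unset Strict Implicit.
Unset Printing Implicit Defensive.
Import Order.TTheory GRing.Theory Num.Theory.
Import numFieldNormedType.Exports.
Local Open Scope classical_set_scope.
Local Open Scope ring_scope.

(** * Submodules and length *)

(** No quotient module is formed: a subquotient is a pair of nested submodules, and a map of
    subquotients is a map of ambient modules compatible with the pairs. Lengths enter as one-sided
    bounds, [len_ge] and [len_le], which make sense before finiteness is known and transfer along
    injections and surjections; exact values are extracted only for [F^n_* K] and for the final
    Koszul homology. The factor a_n occurs both in the upper bound for H_i and in the lower bound
    for H_0, so it cancels in the ratio to [nu], which is of order 1 / q. The exponent d - 1 for i >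
    0 serves twice: it gives this decay, and for i = 1 it makes the losses in the lower bound
    negligible. *)

Lemma proper_sub_trans (T : Type) (L N P : set T) :
  L `<` N -> N `<=` P -> L `<` P.
Proof.
move=> [LN NL] NP; split; first exact: subset_trans NP.
by move=> PL; apply: NL; apply: subset_trans PL.
Qed.

Lemma sub_proper_or_eq (T : Type) (L N : set T) : L `<=` N -> L = N \/ L `<` N.
Proof.
move=> LN; have [NL|NL] := pselect (N `<=` L); last by right.
by left; apply/seteqP.
Qed.

Section Submodules.
Variables (R : comNzRingType) (V : lmodType R).
Implicit Types (L N P : set V) (a : R) (u v : V).

Lemma submoduleP N :
  submodule N <-> N 0 /\ forall a u v, N u -> N v -> N (a *: u + v).
Proof.
rewrite /submodule /GRing.submod_closed; split.
  move=> [/set_mem N0 Nl]; split=> // a u v Nu Nv.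
  by apply: set_mem; apply: Nl; apply: mem_set.
move=> [N0 Nl]; split; first exact: mem_set.
by move=> a u v /set_mem Nu /set_mem Nv; apply: mem_set; apply: Nl.
Qed.

Lemma submodule0 N : submodule N -> N 0.
Proof. by case/submoduleP. Qed.

Lemma submoduleD N u v : submodule N -> N u -> N v -> N (u + v).
Proof. by case/submoduleP=> _ Nl Nu Nv; rewrite -[u]scale1r; apply: Nl. Qed.

Lemma submoduleZ N a u : submodule N -> N u -> N (a *: u).
Proof. by case/submoduleP=> N0 Nl Nu; rewrite -[_ *: _]addr0; apply: Nl. Qed.

Lemma submoduleN N u : submodule N -> N u -> N (- u).
Proof. by move=> sN Nu; rewrite -scaleN1r; apply: submoduleZ. Qed.

Lemma submoduleB N u v : submodule N -> N u -> N v -> N (u - v).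
Proof. by move=> sN Nu Nv; apply: submoduleD => //; apply: submoduleN. Qed.

Lemma submoduleBr N u v : submodule N -> N v -> N (u - v) -> N u.
Proof. by move=> sN Nv Nuv; rewrite -[u](subrK v); apply: submoduleD. Qed.

Lemma submoduleBl N u v : submodule N -> N u -> N (u - v) -> N v.
Proof. by move=> sN Nu Nuv; rewrite -[v](subKr u); apply: submoduleB. Qed.

Lemma submodule_sum N (I : Type) (r : seq I) (Q : pred I) (F : I -> V) :
  submodule N -> (forall i, Q i -> N (F i)) -> N (\sum_(i <- r | Q i) F i).
Proof.
move=> sN NF; apply: big_rec => [|i v Qi Nv]; first exact: submodule0.
by apply: submoduleD => //; apply: NF.
Qed.

Lemma submodule_set0 : submodule [set (0 : V)].
Proof.
by apply/submoduleP; split=> // a u v -> ->; rewrite scaler0 addr0.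
Qed.

Lemma submoduleT : submodule (setT : set V).
Proof. by apply/submoduleP. Qed.

Lemma submoduleI L N : submodule L -> submodule N -> submodule (L `&` N).
Proof.
move=> /submoduleP[L0 Ll] /submoduleP[N0 Nl]; apply/submoduleP; split=> //.
by move=> a u v [Lu Nu] [Lv Nv]; split; [apply: Ll|apply: Nl].
Qed.

(** The sum of two submodules, phrased as the elements congruent modulo [N] to an element of [L]:
    the form in which surjectivity onto a quotient is stated below. *)
Definition addset L N : set V := [set w | exists2 u, L u & N (w - u)].

Lemma submodule_addset L N :
  submodule L -> submodule N -> submodule (addset L N).
Proof.
move=> sL sN; apply/submoduleP; split.
  by exists 0; [exact: submodule0 | rewrite subr0; exact: submodule0].
move=> a u v [u' Lu Nu] [v' Lv Nv]; exists (a *: u' + v').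
  by apply: submoduleD => //; apply: submoduleZ.
rewrite opprD addrACA -scalerBr; apply: submoduleD => //.
exact: submoduleZ.
Qed.

Lemma addsetl L N : submodule N -> L `<=` addset L N.
Proof. by move=> sN u Lu; exists u => //; rewrite subrr; apply: submodule0. Qed.

Lemma addsetr L N : submodule L -> N `<=` addset L N.
Proof. by move=> sL u Nu; exists 0; [exact: submodule0 | rewrite subr0]. Qed.

Lemma addset_sub L N P : submodule P -> L `<=` P -> N `<=` P ->
  addset L N `<=` P.
Proof.
by move=> sP LP NP w [u /LP Pu /NP Pwu]; apply: submoduleBr Pwu.
Qed.

Definition cyclic_span v : set V := [set w | exists a, w = a *: v].

Lemma submodule_cyclic v : submodule (cyclic_span v).
Proof.
apply/submoduleP; split; first by exists 0; rewrite scale0r.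
move=> a _ _ [b ->] [c ->]; exists (a * b + c).
by rewrite scalerDl scalerA.
Qed.

Lemma cyclic_span_id v : cyclic_span v v.
Proof. by exists 1; rewrite scale1r. Qed.

Lemma cyclic_span_sub v N : submodule N -> N v -> cyclic_span v `<=` N.
Proof. by move=> sN Nv _ [a ->]; apply: submoduleZ. Qed.

End Submodules.

Section LinearMaps.
Variables (R : comNzRingType) (V W : lmodType R) (f : V -> W).
Hypothesis f_lin : linear f.

Lemma linear_map0 : f 0 = 0.
Proof.
have := f_lin (-1) 0 0; rewrite !scaleN1r oppr0 addr0.
by rewrite addNr.
Qed.

Lemma linear_mapD u v : f (u + v) = f u + f v.
Proof. by have := f_lin 1 u v; rewrite !scale1r. Qed.

Lemma linear_mapZ a u : f (a *: u) = a *: f u.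
Proof. by have := f_lin a u 0; rewrite !addr0 linear_map0 addr0. Qed.

Lemma linear_mapN u : f (- u) = - f u.
Proof. by rewrite -scaleN1r linear_mapZ scaleN1r. Qed.

Lemma linear_mapB u v : f (u - v) = f u - f v.
Proof. by rewrite linear_mapD linear_mapN. Qed.

Lemma submodule_image N : submodule N -> submodule (f @` N).
Proof.
move=> sN; apply/submoduleP; split.
  by exists 0; [exact: submodule0|exact: linear_map0].
move=> a _ _ [u Nu <-] [v Nv <-]; exists (a *: u + v); last exact: f_lin.
by apply: submoduleD => //; apply: submoduleZ.
Qed.

Lemma submodule_preimage N : submodule N -> submodule (f @^-1` N).
Proof.
move=> /submoduleP[N0 Nl]; apply/submoduleP; split.
  by rewrite /= linear_map0.
by move=> a u v Nu Nv; rewrite /= f_lin; apply: Nl.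
Qed.

End LinearMaps.

Section Length.
Variables (R : comNzRingType) (V : lmodType R).
Implicit Types (L N P C : set V) (k l : nat).

(* There is a strict chain of submodules of length k between L and N; the
   bottom of the chain need not be L, but the top is N. *)
Fixpoint len_ge L N k : Prop :=
  if k is k'.+1 then exists C, [/\ submodule C, len_ge L C k' & C `<` N]
  else L `<=` N.

Definition len_le L N k : Prop := ~ len_ge L N k.+1.

Lemma len_ge_sub L N k : len_ge L N k -> L `<=` N.
Proof.
elim: k N => [//|k IH] N [C [_ /IH LC /properW CN]].
exact: subset_trans CN.
Qed.

Lemma len_ge_mono L L' N N' k :
  L' `<=` L -> N `<=` N' -> len_ge L N k -> len_ge L' N' k.
Proof.
elim: k N N' => [|k IH] N N' LL NN; first by move=> LN x /LL /LN /NN.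
move=> [C [sC LC CN]]; exists C; split=> //; first exact: IH LC.
exact: proper_sub_trans NN.
Qed.

Lemma len_geS L N k : len_ge L N k.+1 -> len_ge L N k.
Proof. by move=> [C [_ LC /properW CN]]; apply: len_ge_mono LC. Qed.

Lemma len_ge_leq L N k l : (k <= l)%N -> len_ge L N l -> len_ge L N k.
Proof.
move=> /subnK <-; elim: (l - k)%N => // j IH /len_geS; exact: IH.
Qed.

Lemma len_geD L N P k l :
  len_ge L N k -> len_ge N P l -> len_ge L P (k + l).
Proof.
move=> LN; elim: l P => [|l IH] P; first by rewrite addn0 => NP;
  apply: len_ge_mono LN.
by move=> [C [sC NC CP]]; rewrite addnS; exists C; split=> //; apply: IH.
Qed.

Lemma len_ge1 L N : submodule L -> L `<` N -> len_ge L N 1.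
Proof. by move=> sL LN; exists L; split=> //=; exact: subset_refl. Qed.

(** By the modular law, a strict step from [C] to [P] stays strict after intersecting with [N] or
    after adding [N]; each step of the chain is charged to one of the two. *)
Lemma len_ge_split L N P k : submodule L -> submodule N -> submodule P ->
  L `<=` N -> len_ge L P k ->
  exists i j, [/\ (k <= i + j)%N, len_ge L (P `&` N) i & len_ge N (addset P N)
    j].
Proof.
move=> sL sN + LN; elim: k P => [|k IH] P sP.
  move=> LP; exists 0%N, 0%N; split=> //=; last exact: addsetr.
  by move=> x Lx; split; [apply: LP | apply: LN].
move=> [C [sC LC CP]]; have [i [j [kij Li Nj]]] := IH C sC LC.
have CNP : addset C N `<=` addset P N.
  by apply: addset_sub; [exact: submodule_addset| |exact: addsetr];
     apply: subset_trans (properW CP) _; exact: addsetl.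
have [eqI|ltI] : C `&` N = P `&` N \/ C `&` N `<` P `&` N.
- by apply: sub_proper_or_eq; apply: setSI; apply: properW.
- exists i, j.+1; split; [by rewrite addnS ltnS|by rewrite -eqI|].
  exists (addset C N); split=> //; first exact: submodule_addset.
  split=> // PC; case: CP => CP; apply=> v Pv.
  have [u Cu Nvu] := PC _ (addsetl sN Pv).
  have : (P `&` N) (v - u) by split=> //; apply: submoduleB => //; apply: CP.
  by rewrite -eqI => -[Cvu _]; apply: submoduleBr Cvu.
- exists i.+1, j; split; [by rewrite addSn ltnS| |exact: len_ge_mono Nj].
  by exists (C `&` N); split=> //; apply: submoduleI.
Qed.

Lemma len_leD L N P k l :
  submodule L -> submodule N -> submodule P -> L `<=` N -> N `<=` P ->
  len_le L N k -> len_le N P l -> len_le L P (k + l).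
Proof.
move=> sL sN sP LN NP LNk NPl /(len_ge_split sL sN sP LN)[i [j [kij Li Nj]]].
have [ki|ik] := ltnP k i.
  by apply: LNk; apply: len_ge_leq ki _; apply: len_ge_mono Li => // v [].
apply: NPl; apply: (@len_ge_leq _ _ _ j); first by lia.
by apply: len_ge_mono Nj => //; apply: addset_sub.
Qed.

Lemma len_geB L N P k l :
  submodule L -> submodule N -> submodule P -> L `<=` N -> N `<=` P ->
  len_ge L P k -> len_le L N l -> len_ge N P (k - l).
Proof.
move=> sL sN sP LN NP; case E : (k - l)%N => [|j] // LPk LNl.
apply: contrapT => NPj; apply: (len_leD sL sN sP LN NP LNl NPj).
by apply: len_ge_leq LPk; lia.
Qed.

Lemma len_le_leq L N k l : (k <= l)%N -> len_le L N k -> len_le L N l.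
Proof. by move=> kl Lk Ll; apply: Lk; apply: len_ge_leq Ll; rewrite ltnS. Qed.

Lemma len_le_id L : len_le L L 0.
Proof. by move=> [C [_ /= LC [_]]]; apply. Qed.

Lemma len_ge_le L N k l : len_ge L N k -> len_le L N l -> (k <= l)%N.
Proof. by move=> Nk Nl; rewrite leqNgt; apply/negP => /len_ge_leq /(_ Nk). Qed.

Lemma len_exact L N k : L `<=` N -> len_le L N k ->
  exists l, [/\ (l <= k)%N, len_ge L N l & len_le L N l].
Proof.
move=> LN; elim: k => [|k IH] Nk; first by exists 0%N.
have [Nk1|Nk1] := pselect (len_ge L N k.+1); first by exists k.+1.
by have [l [lk Ng Nl]] := IH Nk1; exists l; split=> //; rewrite ltnW.
Qed.

(** A chain of maximal length admits no refinement, and its bottom is [L], since a bottom strictly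
    above [L] would give one more step. *)
Lemma len_exact_subquot L N l : submodule L -> submodule N ->
  len_ge L N l -> len_le L N l -> subquot_length L N l.
Proof.
move=> sL; elim: l N => [|l IH] N sN.
  move=> /= LN; have [<- _|LN' /(_ (len_ge1 sL LN'))//] := sub_proper_or_eq LN.
  by exists (fun=> L); split.
move=> [C [sC LC CN]] Nl.
have [//|C' [C0 Cl Csub Cchain]] := IH C sC LC.
  by move=> LCl; apply: Nl; exists C.
exists (fun i => if (i <= l)%N then C' i else N); split=> //.
- by rewrite ltnn.
- by move=> i _; case: ifP => // il; apply: Csub.
move=> i; rewrite ltnS => il; rewrite il; case: (ltnP i l) => [il'|li].
  exact: Cchain.
have -> : i = l by lia.
rewrite Cl; split=> // D sD [CD DN]; apply: Nl; exists D; split=> //.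
by exists C.
Qed.

End Length.

Section LengthMaps.
Variables (R : comNzRingType) (V W : lmodType R) (f : V -> W).
Hypothesis f_lin : linear f.

(** The part of [Z] that [f] sends into [B'] lies in [B], so [Z] modulo [B] is a subquotient of [Z']
    modulo [B']. A chain is transported by taking images and adding [B']. *)
Lemma len_ge_inj (B Z : set V) (B' Z' : set W) k :
  submodule Z -> submodule B' -> submodule Z' -> f @` Z `<=` Z' -> B' `<=` Z' ->
  (forall v, Z v -> B' (f v) -> B v) -> len_ge B Z k -> len_ge B' Z' k.
Proof.
move=> + sB'; elim: k Z Z' => [//|k IH] Z Z' sZ sZ' fZ B'Z' inj [C [sC BC CZ]].
have sfC := submodule_image f_lin sC.
exists (addset (f @` C) B'); split; first exact: submodule_addset.
  apply: IH BC => //; [exact: submodule_addset|exact: addsetl|exact: addsetr|].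
  by move=> v /(properW CZ); apply: inj.
split.
  apply: addset_sub => // _ [v Cv <-]; apply: fZ; exists v => //.
  exact: (properW CZ).
case: CZ => CZ ZC Z'C; apply: ZC => v Zv.
have [_ [u Cu <-]] : addset (f @` C) B' (f v) by apply: Z'C; apply: fZ;
  exists v.
rewrite -(linear_mapB f_lin) => Bvu; apply: (@submoduleBr _ _ _ _ u) => //.
by apply: (len_ge_sub BC); apply: inj => //; apply: submoduleB => //; apply: CZ.
Qed.

Lemma len_le_inj (B Z : set V) (B' Z' : set W) k :
  submodule Z -> submodule B' -> submodule Z' -> f @` Z `<=` Z' -> B' `<=` Z' ->
  (forall v, Z v -> B' (f v) -> B v) -> len_le B' Z' k -> len_le B Z k.
Proof.
by move=> sZ sB' sZ' fZ B'Z' inj B'k Bk; apply: B'k; apply: len_ge_inj Bk.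
Qed.

(** [f] induces a surjection of [Z] modulo [B] onto [Z'] modulo [B'], along which chains are pulled
    back. *)
Lemma len_ge_surj (B Z : set V) (B' Z' : set W) k :
  submodule Z -> B `<=` Z -> (forall v, B v -> B' (f v)) ->
  (forall w, Z' w -> exists2 v, Z v & B' (w - f v)) ->
  len_ge B' Z' k -> len_ge B Z k.
Proof.
move=> + + fB; elim: k Z Z' => [//|k IH] Z Z' sZ BZ surj [C [sC BC CZ]].
have sfC := submodule_preimage f_lin sC.
exists (Z `&` f @^-1` C); split; first exact: submoduleI.
  apply: IH (BC); first exact: submoduleI.
    move=> v Bv; split; first exact: BZ.
    exact: (len_ge_sub BC) (fB _ Bv).
  move=> w Cw; have [v Zv Bwv] := surj _ (properW CZ Cw).
  exists v => //; split=> //=; by apply: (submoduleBl sC Cw);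
    apply: (len_ge_sub BC).
split=> [v []//|ZC]; case: CZ => CZ; apply=> w Z'w.
have [v /ZC[Zv Cv] Bwv] := surj _ Z'w.
exact: submoduleBr sC Cv (len_ge_sub BC Bwv).
Qed.

Lemma len_le_surj (B Z : set V) (B' Z' : set W) k :
  submodule Z -> B `<=` Z -> (forall v, B v -> B' (f v)) ->
  (forall w, Z' w -> exists2 v, Z v & B' (w - f v)) ->
  len_le B Z k -> len_le B' Z' k.
Proof. by move=> sZ BZ fB surj Bk B'k; apply: Bk; apply: len_ge_surj B'k. Qed.

End LengthMaps.

(** * Koszul homology of subquotients *)

Definition tail T d (x : 'I_d.+1 -> T) : 'I_d -> T := fun k => x (lift ord0 k).

Lemma ffun_addE (T : finType) (V : zmodType) (f g : {ffun T -> V}) t :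
  (f + g) t = f t + g t.
Proof. by rewrite ffunE. Qed.

Lemma ffun_oppE (T : finType) (V : zmodType) (f : {ffun T -> V}) t :
  (- f) t = - f t.
Proof. by rewrite ffunE. Qed.

Lemma ffun_scaleE (R : comNzRingType) (T : finType) (V : lmodType R) a
  (f : {ffun T -> V}) t : (a *: f) t = a *: f t.
Proof. by rewrite ffunE. Qed.

Section KoszulChains.
Variables (R : comNzRingType) (V : lmodType R).
Implicit Types (L N P : set V) (a : R).

Definition kchain d i N : set {ffun {set 'I_d} -> V} :=
  [set f | koszul_deg i f /\ forall J, N (f J)].

(* kcyc x i N L modulo kbound x i N L is H_i(x; N / L), computed with lifts to
   the ambient module so that no quotient module has to be formed. *)
Definition kcyc d (x : 'I_d -> R) i N L : set {ffun {set 'I_d} -> V} :=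
  [set f | kchain i N f /\ forall J, L (koszul_d x f J)].

Definition kbound d (x : 'I_d -> R) i N L : set {ffun {set 'I_d} -> V} :=
  addset (@koszul_d R d x V @` kchain i.+1 N) (kchain i L).

Lemma koszul_d_linear d (x : 'I_d -> R) : linear (@koszul_d R d x V).
Proof.
move=> a f g; apply/ffunP => J; rewrite !ffunE scaler_sumr -big_split /=.
apply: eq_bigr => k _; rewrite !ffunE scalerDr !scalerA.
by rewrite [a * _]mulrC.
Qed.

Lemma koszul_d_deg d (x : 'I_d -> R) i (f : {ffun {set 'I_d} -> V}) :
  koszul_deg i.+1 f -> koszul_deg i (koszul_d x f).
Proof.
move=> fi J Ji; rewrite ffunE big1 // => k kJ.
by rewrite fi ?scaler0 // cardsU1 kJ eqSS.
Qed.

Lemma koszul_d_deg0 d (x : 'I_d -> R) (f : {ffun {set 'I_d} -> V}) :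
  koszul_deg 0 f -> koszul_d x f = 0.
Proof.
move=> f0; apply/ffunP => J; rewrite !ffunE big1 // => k kJ.
by rewrite f0 ?scaler0 // cardsU1 kJ.
Qed.

Lemma koszul_d_val d (x : 'I_d -> R) N (f : {ffun {set 'I_d} -> V}) :
  submodule N -> (forall J, N (f J)) -> forall J, N (koszul_d x f J).
Proof.
move=> sN Nf J; rewrite ffunE; apply: submodule_sum => // k _.
exact: submoduleZ.
Qed.

Lemma submodule_kchain d i N : submodule N -> submodule (@kchain d i N).
Proof.
move=> sN; apply/submoduleP; split.
  by split=> J; rewrite ?ffunE //; apply: submodule0.
move=> a f g [fi Nf] [gi Ng]; split=> J.
  by move=> Ji; rewrite !ffunE fi // gi // scaler0 addr0.
by rewrite !ffunE; apply: submoduleD => //; apply: submoduleZ.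
Qed.

Lemma kchain_sub d i N P : N `<=` P -> @kchain d i N `<=` kchain i P.
Proof. by move=> NP f [fi Nf]; split=> // J; apply: NP. Qed.

Lemma kchain_d d (x : 'I_d -> R) i N f : submodule N ->
  kchain i.+1 N f -> kchain i N (koszul_d x f).
Proof.
move=> sN [fi Nf]; split; first exact: koszul_d_deg.
exact: koszul_d_val.
Qed.

Lemma submodule_kcyc d (x : 'I_d -> R) i N L :
  submodule N -> submodule L -> submodule (kcyc x i N L).
Proof.
move=> sN sL; apply/submoduleP; split.
  split; first exact: submodule0 (submodule_kchain d i sN).
  by move=> J; rewrite (linear_map0 (koszul_d_linear x)) ffunE;
    apply: submodule0.
move=> a f g [Nf Lf] [Ng Lg]; split.
  have sK := submodule_kchain d i sN.
  by apply: submoduleD => //; apply: submoduleZ.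
move=> J; rewrite koszul_d_linear ffunE [X in L (X + _)]ffunE.
by apply: submoduleD => //; apply: submoduleZ.
Qed.

Lemma submodule_kbound d (x : 'I_d -> R) i N L :
  submodule N -> submodule L -> submodule (kbound x i N L).
Proof.
move=> sN sL; apply: submodule_addset; last exact: submodule_kchain.
exact: (submodule_image (koszul_d_linear x) (submodule_kchain d i.+1 sN)).
Qed.

Lemma kbound_d d (x : 'I_d -> R) i N L g : submodule L ->
  kchain i.+1 N g -> kbound x i N L (koszul_d x g).
Proof.
by move=> sL Ng; apply: addsetl; [exact: submodule_kchain|exists g].
Qed.

Lemma kbound_val d (x : 'I_d -> R) i N L h : submodule N ->
  kchain i L h -> kbound x i N L h.
Proof.
move=> sN; apply: addsetr.
exact: (submodule_image (koszul_d_linear x) (submodule_kchain d i.+1 sN)).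
Qed.

Lemma kbound_kchain d (x : 'I_d -> R) i N L :
  submodule N -> L `<=` N -> kbound x i N L `<=` kchain i N.
Proof.
move=> sN LN; apply: addset_sub; [exact: submodule_kchain| |exact: kchain_sub].
by move=> _ [g Ng <-]; apply: kchain_d.
Qed.

(* Chains are split along e_0: c0 f is the part not involving e_0, and c1 f is
   the cofactor of e_0. *)
Definition c0 d (f : {ffun {set 'I_d.+1} -> V}) : {ffun {set 'I_d} -> V} :=
  [ffun J : {set 'I_d} => f (lift ord0 @: J)].

Definition c1 d (f : {ffun {set 'I_d.+1} -> V}) : {ffun {set 'I_d} -> V} :=
  [ffun J : {set 'I_d} => f (ord0 |: lift ord0 @: J)].

Lemma c0E d (f : {ffun {set 'I_d.+1} -> V}) J : c0 f J = f (lift ord0 @: J).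
Proof. by rewrite ffunE. Qed.

Lemma c1E d (f : {ffun {set 'I_d.+1} -> V}) J :
  c1 f J = f (ord0 |: lift ord0 @: J).
Proof. by rewrite ffunE. Qed.

Definition kpair d (g0 g1 : {ffun {set 'I_d} -> V}) :
    {ffun {set 'I_d.+1} -> V} :=
  [ffun J : {set 'I_d.+1} => let J' := (lift ord0 @^-1: J)%SET in
    if ord0 \in J then g1 J' else g0 J'].

Lemma lift0_notin d (J : {set 'I_d}) : ord0 \notin lift ord0 @: J.
Proof. by apply/negP => /imsetP[k _ /eqP]; rewrite (negbTE (neq_lift _ _)). Qed.

Lemma mem_lift0 d (J : {set 'I_d}) k : (lift ord0 k \in lift ord0 @: J) = (k
  \in J).
Proof. by rewrite mem_imset //; apply: lift_inj. Qed.

Lemma lift0_split d (J : {set 'I_d.+1}) :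
  J = (if ord0 \in J then ord0 |: lift ord0 @: (lift ord0 @^-1: J)
       else lift ord0 @: (lift ord0 @^-1: J))%SET.
Proof.
apply/setP => k; case: ifPn => J0; case: (unliftP ord0 k) => [k' ->|->].
- by rewrite !inE eq_sym (negbTE (neq_lift _ _)) mem_lift0 inE.
- by rewrite !inE eqxx.
- by rewrite mem_lift0 inE.
- by rewrite (negbTE J0) (negbTE (lift0_notin _)).
Qed.

Lemma kchain_ind d (T : {ffun {set 'I_d.+1} -> V} -> {set 'I_d.+1} -> Prop) f :
  (forall J : {set 'I_d}, T f (lift ord0 @: J)) ->
  (forall J : {set 'I_d}, T f (ord0 |: lift ord0 @: J)) -> forall J, T f J.
Proof. by move=> T0 T1 J; rewrite (lift0_split J); case: ifP. Qed.

Lemma c01_inj d (f g : {ffun {set 'I_d.+1} -> V}) :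
  c0 f = c0 g -> c1 f = c1 g -> f = g.
Proof.
move=> /ffunP e0 /ffunP e1; apply/ffunP;
  apply: (kchain_ind (T := fun f J => f J = g J)) => J.
  by have := e0 J; rewrite !ffunE.
by have := e1 J; rewrite !ffunE.
Qed.

Lemma lift0_preim d (J : {set 'I_d}) : (lift ord0 @^-1: (lift ord0 @: J) =
  J)%SET.
Proof. by apply/setP => k; rewrite inE mem_lift0. Qed.

Lemma lift0_preimU d (J : {set 'I_d}) :
  (lift ord0 @^-1: (ord0 |: lift ord0 @: J) = J)%SET.
Proof.
by apply/setP => k; rewrite !inE eq_sym (negbTE (neq_lift _ _)) mem_lift0.
Qed.

Lemma c0_kpair d (g0 g1 : {ffun {set 'I_d} -> V}) : c0 (kpair g0 g1) = g0.
Proof.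
by apply/ffunP => J; rewrite !ffunE (negbTE (lift0_notin _)) lift0_preim.
Qed.

Lemma c1_kpair d (g0 g1 : {ffun {set 'I_d} -> V}) : c1 (kpair g0 g1) = g1.
Proof. by apply/ffunP => J; rewrite !ffunE setU11 lift0_preimU. Qed.

Lemma c0_linear d : linear (@c0 d).
Proof. by move=> a f g; apply/ffunP => J; rewrite !ffunE. Qed.

Lemma c1_linear d : linear (@c1 d).
Proof. by move=> a f g; apply/ffunP => J; rewrite !ffunE. Qed.

(** With [c1_koszul_d], this presents the Koszul complex as the mapping cone of multiplication by
    x_0 on the complex of the tail. No index lies below 0, so the term removing e_0 carries no
    sign. *)
Lemma c0_koszul_d d (x : 'I_d.+1 -> R) f :
  c0 (koszul_d x f) = koszul_d (tail x) (c0 f) + x ord0 *: c1 f.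
Proof.
apply/ffunP => J; rewrite !ffunE big_mkcond big_ord_recl /= (lift0_notin J).
rewrite addrC [in RHS]big_mkcond; congr (_ + _).
  apply: eq_bigr => k _; rewrite mem_lift0; case: ifP => // _.
  rewrite ffunE imsetU1; congr ((_ ^+ _ * _) *: _).
  rewrite -[RHS](card_imset _ (@lift_inj _ ord0)); apply: eq_card => j.
  rewrite !inE; apply/andP/imsetP => [[/imsetP[j' Jj' ->] ltj]|[j' + ->]].
    by exists j'; rewrite // inE Jj'.
  by rewrite inE => /andP[Jj' ltj]; rewrite mem_lift0.
set s := #|_|; suff -> : s = 0%N by rewrite mul1r.
by apply: eq_card0 => j; rewrite !inE andbF.
Qed.

Lemma c1_koszul_d d (x : 'I_d.+1 -> R) f :
  c1 (koszul_d x f) = - koszul_d (tail x) (c1 f).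
Proof.
apply/ffunP => J; rewrite !ffunE big_mkcond big_ord_recl /= setU11 add0r.
rewrite [in RHS]big_mkcond -sumrN /=; apply: eq_bigr => k _.
rewrite !inE eq_sym (negbTE (neq_lift _ _)) /= mem_lift0; case: ifP => [_|_];
  last by rewrite oppr0.
rewrite ffunE imsetU1 finset.setUCA -scaleNr -mulNr -[- (_ ^+ _)]mulN1r -exprS;
  congr ((_ ^+ _ * _) *: _).
rewrite -[in RHS](card_imset _ (@lift_inj _ ord0)) -[RHS]add1n.
(* The index 0 is one more index below [k], hence the minus sign; as a boolean, this 1 is the
   summand in [cardsU1]. *)
rewrite -[X in (X + _)%N]/(nat_of_bool true) -(lift0_notin [set j in J | (j <
  k)%N]).
rewrite -cardsU1; apply: eq_card => j.
rewrite !inE; case: (unliftP ord0 j) => [j' ->|->]; last by rewrite eqxx.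
by rewrite eq_sym (negbTE (neq_lift _ _)) /= !mem_lift0 !inE.
Qed.

(** In the cone description the two mixed terms, x_0 times the differential of the cofactor, cancel;
    the rest is the statement for the tail. *)
Lemma koszul_dd d (x : 'I_d -> R) f : koszul_d x (koszul_d x f) = 0 :> {ffun _
  -> V}.
Proof.
elim: d x f => [|d IH] x f.
  by apply/ffunP => J; rewrite !ffunE big_ord0.
have kL := koszul_d_linear (tail x).
apply: c01_inj; rewrite ?c0_koszul_d !c1_koszul_d ?c0_koszul_d.
  rewrite (linear_mapD kL) (linear_mapZ kL) IH add0r scalerN subrr.
  by rewrite (linear_map0 (@c0_linear d)).
rewrite (linear_mapN kL) IH oppr0 oppr0.
by rewrite (linear_map0 (@c1_linear d)).
Qed.

(** The cofactor of e_0 in a chain of degree [i] has degree [i - 1]; for [i = 0] it vanishes. *)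
Definition kchain1 d i N : set {ffun {set 'I_d} -> V} :=
  if i is i'.+1 then kchain i' N else [set 0].

Lemma kchainE d i N (f : {ffun {set 'I_d.+1} -> V}) : submodule N ->
  kchain i N f <-> kchain i N (c0 f) /\ kchain1 i N (c1 f).
Proof.
move=> sN; have cardU (J : {set 'I_d}) : #|ord0 |: lift ord0 @: J| = #|J|.+1.
  by rewrite cardsU1 lift0_notin card_imset //; apply: lift_inj.
have card0 (J : {set 'I_d}) : #|lift ord0 @: J| = #|J|.
  by rewrite card_imset //; apply: lift_inj.
split=> [[fi Nf]|[[fi Nf] f1]].
  split; first by split=> J; rewrite ffunE ?card0 // => Ji; rewrite fi ?card0.
  case: i fi => [|i] fi; first by apply/ffunP => J; rewrite !ffunE fi // cardU.
  by split=> J; rewrite ffunE // => Ji; rewrite fi // cardU eqSS.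
split.
  apply: (kchain_ind (T := fun f J => #|J| != i -> f J = 0)) => J.
    by rewrite card0 => Ji; have := fi J Ji; rewrite ffunE.
  rewrite cardU; case: i f1 {fi} => [/ffunP/(_ J)|i [/(_ J) + _]];
    rewrite !ffunE //.
apply: (kchain_ind (T := fun f J => N (f J))) => J.
  by have := Nf J; rewrite ffunE.
case: i f1 {fi} => [/ffunP/(_ J)|i [_ /(_ J)]]; rewrite !ffunE //.
by move=> ->; apply: submodule0.
Qed.

Lemma kchain1_val d i N (f : {ffun {set 'I_d} -> V}) : submodule N ->
  kchain1 i N f -> forall J, N (f J).
Proof.
move=> sN; case: i => [->|i [_ //]] J.
by rewrite ffunE; apply: submodule0.
Qed.

End KoszulChains.

Lemma id_linear (R : comNzRingType) (V : lmodType R) : linear (fun v : V => v).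
Proof. by []. Qed.

Lemma scale_linear (R : comNzRingType) (V : lmodType R) (a : R) :
  linear (fun v : V => a *: v).
Proof. by move=> b u v; rewrite scalerDr !scalerA mulrC. Qed.

Section KoszulMaps.
Variables (R : comNzRingType) (V W : lmodType R) (f : V -> W).
Hypothesis f_lin : linear f.

Definition kmap d (g : {ffun {set 'I_d} -> V}) : {ffun {set 'I_d} -> W} :=
  [ffun J : {set 'I_d} => f (g J)].

Lemma kmap_linear d : linear (@kmap d).
Proof. by move=> a g h; apply/ffunP => J; rewrite !ffunE f_lin. Qed.

Lemma kmap_d d (x : 'I_d -> R) g : kmap (koszul_d x g) = koszul_d x (kmap g).
Proof.
apply/ffunP => J; rewrite !ffunE.
rewrite (big_morph f (linear_mapD f_lin) (linear_map0 f_lin)).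
by apply: eq_bigr => k _; rewrite (linear_mapZ f_lin) ffunE.
Qed.

Lemma kchain_map d i (N : set V) (g : {ffun {set 'I_d} -> V}) :
  kchain i N g -> kchain i (f @` N) (kmap g).
Proof.
move=> [gi Ng]; split=> J; rewrite ffunE; last by exists (g J).
by move=> Ji; rewrite gi // (linear_map0 f_lin).
Qed.

End KoszulMaps.

(** Lifts are chosen coordinate by coordinate and set to 0 outside degree [i], where [Q 0 0] takes
    over. *)
Lemma kchain_lift (R : comNzRingType) (V W : lmodType R) d i
    (Q : V -> W -> Prop) (N : set V) (P : set W) (f : {ffun {set 'I_d} -> W}) :
  N 0 -> Q 0 0 -> (forall w, P w -> exists2 v, N v & Q v w) -> kchain i P f ->
  exists2 g : {ffun {set 'I_d} -> V}, kchain i N g & forall J, Q (g J) (f J).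
Proof.
move=> N0 Q0 PQ [fi Pf].
have /choice[h hP] : forall J, exists v, N v /\ Q v (f J).
  by move=> J; have [v Nv Qv] := PQ _ (Pf J); exists v.
exists [ffun J : {set 'I_d} => if #|J| == i then h J else 0].
  by split=> J; rewrite ffunE; [move/negbTE->|case: ifP => // _; case: (hP J)].
by move=> J; rewrite ffunE; case: ifPn => [_|/fi->//]; case: (hP J).
Qed.

(** * Exact sequences for Koszul homology, as length bounds *)

Section KoszulHomology.
Variables (R : comNzRingType) (V : lmodType R).
Implicit Types (L N P : set V) (a : R).

Definition hlen_le d (x : 'I_d -> R) i N L k :=
  len_le (kbound x i N L) (kcyc x i N L) k.

Definition hlen_ge d (x : 'I_d -> R) i N L k :=
  len_ge (kbound x i N L) (kcyc x i N L) k.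

Lemma kbound_kcyc d (x : 'I_d -> R) i N L :
  submodule N -> submodule L -> L `<=` N -> kbound x i N L `<=` kcyc x i N L.
Proof.
move=> sN sL LN; apply: addset_sub; first exact: submodule_kcyc.
  move=> _ [g Ng <-]; split=> [|J]; first exact: kchain_d.
  by rewrite koszul_dd ffunE; apply: submodule0.
by move=> h Lh; split; [apply: kchain_sub Lh|case: Lh => _;
  apply: koszul_d_val].
Qed.

Lemma kbound_mono d (x : 'I_d -> R) i N N' L L' :
  N `<=` N' -> L `<=` L' -> kbound x i N L `<=` kbound x i N' L'.
Proof.
move=> NN LL f [_ [g Ng <-] Lfg]; exists (koszul_d x g).
  by exists g => //; apply: kchain_sub Ng.
exact: kchain_sub Lfg.
Qed.

(** Exactness of H_i(N / L) -> H_i(P / L) -> H_i(P / N) in the middle: [Bmid] represents the kernel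
    of the second map and is covered by the first. *)
Lemma hlen_leD d (x : 'I_d -> R) i L N P k l :
  submodule L -> submodule N -> submodule P -> L `<=` N -> N `<=` P ->
  hlen_le x i N L k -> hlen_le x i P N l -> hlen_le x i P L (k + l).
Proof.
move=> sL sN sP LN NP Nk Pl; have LP := subset_trans LN NP.
pose Bmid := kcyc x i P L `&` kbound x i P N.
have sZ := submodule_kcyc x i sP sL.
have sBmid : submodule Bmid.
  by apply: submoduleI; [exact: submodule_kcyc|exact: submodule_kbound].
have BB : kbound x i P L `<=` Bmid.
  by move=> f Bf; split; [exact: kbound_kcyc Bf|exact: kbound_mono Bf].
apply: (@len_leD _ _ _ Bmid) => //; [exact: submodule_kbound|by move=> f []| |].
  apply: (len_le_surj (@id_linear _ _) _ _ _ _ Nk).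
  - exact: submodule_kcyc.
  - exact: kbound_kcyc.
  - by move=> f; apply: kbound_mono.
  move=> f [[Pf Lf] [_ [g Pg <-] Nfg]]; exists (f - koszul_d x g).
    split=> // J; rewrite (linear_mapB (koszul_d_linear x)) koszul_dd subr0.
    exact: Lf.
  by rewrite subKr; apply: kbound_d.
apply: (len_le_inj (@id_linear _ _) _ _ _ _ _ _ Pl) => //.
- exact: submodule_kbound.
- exact: submodule_kcyc.
- by move=> _ [f [Pf Lf] <-]; split=> // J; apply: LN.
- exact: kbound_kcyc.
Qed.

Lemma hlen_le_id d (x : 'I_d -> R) i N : submodule N -> hlen_le x i N N 0.
Proof.
move=> sN [C [_ /= BC [_]]]; apply; apply: subset_trans BC.
by move=> f [Nf _]; apply: kbound_val.
Qed.

Lemma kcyc0 d (x : 'I_d -> R) N L : submodule L -> kcyc x 0 N L = kchain 0 N.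
Proof.
move=> sL; apply/seteqP; split=> [f []//|f [f0 Nf]]; split=> // J.
by rewrite koszul_d_deg0 // ffunE; apply: submodule0.
Qed.

(* The connecting map H_1(P/N) -> H_0(N/L) bounds what H_0(N/L) loses in
   H_0(P/L). *)
Lemma hlen_ge0D d (x : 'I_d -> R) L N P k b l :
  submodule L -> submodule N -> submodule P -> L `<=` N -> N `<=` P ->
  hlen_ge x 0 N L k -> hlen_le x 1 P N b -> hlen_ge x 0 P N l ->
  hlen_ge x 0 P L (k - b + l).
Proof.
move=> sL sN sP LN NP Nk Pb Pl; have LP := subset_trans LN NP.
have sKN := submodule_kchain d 0 sN.
rewrite /hlen_ge !kcyc0 // in Nk Pl *.
apply: len_geD Pl.
(* [B] represents the kernel of H_0(N / L) -> H_0(P / L); the connecting map covering it is, on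
   lifts, [koszul_d] itself. *)
pose B := kbound x 0 P L `&` kchain 0 N.
have sB : submodule B by apply: submoduleI => //; exact: submodule_kbound.
suff : len_ge B (kchain 0 N) (k - b).
  apply: (len_ge_inj (@id_linear _ _)) => //; try exact: submodule_kbound.
  - by move=> _ [f Nf <-]; apply: kbound_val.
  - exact: kbound_mono.
apply: (len_geB _ _ _ _ _ Nk) => //; first exact: submodule_kbound.
- move=> f Bf; split; first exact: kbound_mono Bf.
  exact: kbound_kchain Bf.
- by move=> f [].
apply: (len_le_surj (koszul_d_linear x) _ _ _ _ Pb).
- exact: submodule_kcyc.
- exact: kbound_kcyc.
- move=> f [_ [g Pg <-] Nfg].
  rewrite -[f](subrKC (koszul_d x g)) (linear_mapD (koszul_d_linear x)).
  by rewrite koszul_dd add0r; apply: kbound_d.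
- move=> f [[_ [g Pg <-] Lfg] Nf]; exists g; last exact: kbound_val.
  split=> // J; have [_ /(_ J)] := submoduleBl sKN Nf (kchain_sub LN Lfg).
  exact.
Qed.

Definition smul a N : set V := (fun v => a *: v) @` N.

Lemma submodule_smul a N : submodule N -> submodule (smul a N).
Proof. exact/submodule_image/scale_linear. Qed.

Lemma smul_sub a N P : submodule P -> N `<=` P -> smul a N `<=` P.
Proof. by move=> sP NP _ [v /NP Pv <-]; apply: submoduleZ. Qed.

Lemma kchain_addset_smul d a L N (f : {ffun {set 'I_d} -> V}) i :
  submodule N -> submodule L -> kchain i (addset (smul a N) L) f ->
  exists2 g : {ffun {set 'I_d} -> V}, kchain i N g & kchain i L (f - a *: g).
Proof.
move=> sN sL aNf; have [|||g Ng Lg] := kchain_lift (N := N)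
  (Q := fun v w : V => L (w - a *: v)) _ _ _ aNf.
- exact: submodule0.
- by rewrite scaler0 subr0; apply: submodule0.
- by move=> w [_ [v Nv <-] Lwv]; exists v.
exists g => //; split=> J; last by rewrite !ffunE; apply: Lg.
by case: aNf Ng => fi _ [gi _] Ji; rewrite !ffunE fi // gi // scaler0 subr0.
Qed.

Lemma kchain_scale d a L N (g : {ffun {set 'I_d} -> V}) i :
  submodule L -> kchain i N g -> kchain i (addset (smul a N) L) (a *: g).
Proof.
move=> sL [gi Ng]; split=> J; rewrite ffunE.
  by move=> Ji; rewrite gi // scaler0.
by apply: addsetl => //; exists (g J).
Qed.

(** For x_0 regular on N / L, [c0] embeds H_i(x; N / L) into H_i of the tail on N / (x_0 N + L). *)
Lemma hlen_le_regular d (x : 'I_d.+1 -> R) i L N k :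
  submodule L -> submodule N -> L `<=` N ->
  (forall v, N v -> L (x ord0 *: v) -> L v) ->
  hlen_le (tail x) i N (addset (smul (x ord0) N) L) k -> hlen_le x i N L k.
Proof.
set a := x ord0 => sL sN LN reg.
have saN := submodule_smul a sN.
have saNL := submodule_addset saN sL.
have aNL_N : addset (smul a N) L `<=` N.
  by apply: addset_sub => //; apply: smul_sub.
apply: (len_le_inj (@c0_linear _ _ _)).
- exact: submodule_kcyc.
- exact: submodule_kbound.
- exact: submodule_kcyc.
- move=> _ [f [/(kchainE _ _ sN)[Nf0 Nf1] Lf] <-]; split=> // J.
  exists (a *: - c1 f J).
    by exists (- c1 f J) => //; apply: submoduleN => //;
      apply: kchain1_val Nf1 J.
  have := Lf (lift ord0 @: J); rewrite -c0E c0_koszul_d ffun_addE ffun_scaleE.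
  by rewrite scalerN opprK.
- exact: kbound_kcyc.
move=> f [Nf Lf] [_ [g Ng <-] /(kchain_addset_smul sN sL)[h Nh Lh]].
have NG : kchain i.+1 N (kpair g h).
  by apply/(kchainE _ _ sN); rewrite c0_kpair c1_kpair.
(* Subtracting this boundary pushes the e_0-free part into [L]; the cycle condition then puts x_0
   times the cofactor into [L], and regularity the cofactor itself. *)
exists (koszul_d x (kpair g h)); first by exists (kpair g h).
set e := f - _.
have e0 : c0 e = c0 f - koszul_d (tail x) g - a *: h.
  rewrite (linear_mapB (@c0_linear _ _ _)) c0_koszul_d c0_kpair c1_kpair.
  by rewrite opprD addrA.
have Ne : kchain i N e.
  by apply: submoduleB => //; [exact: submodule_kchain|exact: kchain_d].
have Le0 J : L (c0 e J) by rewrite e0; case: Lh => _; apply.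
have Lde J : L (koszul_d x e J).
  by rewrite (linear_mapB (koszul_d_linear x)) koszul_dd subr0.
split; first by case: Ne.
apply: (kchain_ind (T := fun f J => L (f J))) => J; first by rewrite -c0E.
apply: reg; first by case: Ne.
have := Lde (lift ord0 @: J);
  rewrite -c0E c0_koszul_d ffun_addE ffun_scaleE c1E addrC.
move=> Ld; apply: (@submoduleBr _ _ _ _ (- koszul_d (tail x) (c0 e) J)) => //.
  by apply: submoduleN => //; apply: koszul_d_val.
by rewrite opprK.
Qed.

Lemma hlen_ge0_tail d (x : 'I_d.+1 -> R) L N k :
  submodule L -> submodule N -> L `<=` N ->
  hlen_ge (tail x) 0 N (addset (smul (x ord0) N) L) k -> hlen_ge x 0 N L k.
Proof.
set a := x ord0 => sL sN LN; have saN := submodule_smul a sN.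
rewrite /hlen_ge !kcyc0 //; last exact: submodule_addset.
apply: (len_ge_surj (@c0_linear _ _ _)).
- exact: submodule_kchain.
- exact: kbound_kchain.
- move=> f [_ [g /(kchainE _ _ sN)[Ng0 Ng1] <-] /(kchainE _ _ sL)[Lfg _]].
  exists (koszul_d (tail x) (c0 g)); first by exists (c0 g).
  have -> : c0 f - koszul_d (tail x) (c0 g) = c0 (f - koszul_d x g) + a *: c1 g.
    by rewrite (linear_mapB (@c0_linear _ _ _)) c0_koszul_d opprD addrA subrK.
  apply: submoduleD; first exact/submodule_kchain/submodule_addset.
    by apply: kchain_sub Lfg; apply: addsetr.
  exact: kchain_scale.
- move=> f Nf; exists (kpair f 0).
    apply/(kchainE _ _ sN); rewrite c0_kpair c1_kpair; split=> //=.
  rewrite c0_kpair subrr; apply: submodule0; apply: submodule_kbound => //.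
  exact: submodule_addset.
Qed.

(** The map from H_i of the tail to H_i of [x] reaches the class of every cycle whose cofactor lies
    in [L] up to a boundary. [Z] is the set of all cycles in degree 0, and in higher degree the
    kernel of the map to H_(i-1) of the tail. *)
Lemma cone_surj d (x : 'I_d.+1 -> R) i L N k (Z : set {ffun {set 'I_d.+1} ->
  V}) :
  submodule L -> submodule N -> L `<=` N -> submodule Z -> Z `<=` kcyc x i N L
    ->
  (forall f, Z f -> exists2 g, kchain i.+1 N g & kchain1 i L (c1 (f - koszul_d
    x g))) ->
  (forall f, kcyc (tail x) i N L f -> Z (kpair f 0)) ->
  hlen_le (tail x) i N L k -> len_le (kbound x i N L) Z k.
Proof.
move=> sL sN LN sZ Zcyc Zc1 Zpair.
have kpair_linear : linear (fun f : {ffun {set 'I_d} -> V} => kpair f 0).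
  move=> b f g; apply: c01_inj.
    by rewrite c0_kpair (@c0_linear _ _ _) !c0_kpair.
  by rewrite c1_kpair (@c1_linear _ _ _) !c1_kpair scaler0 addr0.
apply: (len_le_surj kpair_linear).
- exact: submodule_kcyc.
- exact: kbound_kcyc.
- move=> f [_ [g Ng <-] Lfg]; exists (koszul_d x (kpair g 0)).
    exists (kpair g 0) => //; apply/(kchainE _ _ sN); rewrite c0_kpair c1_kpair.
    by split=> //; apply: submodule0; apply: submodule_kchain.
  apply/(kchainE _ _ sL); rewrite (linear_mapB (@c0_linear _ _ _)).
  rewrite (linear_mapB (@c1_linear _ _ _)) c0_koszul_d c1_koszul_d !c0_kpair
    !c1_kpair.
  rewrite scaler0 addr0 (linear_map0 (koszul_d_linear _)) oppr0 subr0;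
    split=> //.
  case: i {Zcyc Zc1 Zpair Ng Lfg} => [//|i].
  by apply: submodule0; apply: submodule_kchain.
move=> f Zf; have [[Nf Lf] [g Ng Lfg]] := (Zcyc _ Zf, Zc1 _ Zf).
set e := f - koszul_d x g in Lfg.
have Ne : kchain i N e.
  by apply: submoduleB => //; [exact: submodule_kchain|exact: kchain_d].
exists (c0 e).
  split=> [|J]; first by case/(kchainE _ _ sN): Ne.
  have : L (koszul_d x e (lift ord0 @: J)).
    by rewrite (linear_mapB (koszul_d_linear x)) koszul_dd subr0.
  rewrite -c0E c0_koszul_d ffun_addE ffun_scaleE => Ld.
  rewrite -[koszul_d _ _ _](addrK (x ord0 *: c1 e J)).
  by apply: submoduleB => //; apply: submoduleZ => //;
    apply: (kchain1_val sL Lfg).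
exists (koszul_d x g); first by exists g.
have -> : f - kpair (c0 e) 0 - koszul_d x g = e - kpair (c0 e) 0.
  by rewrite addrAC.
apply/(kchainE _ _ sL); rewrite (linear_mapB (@c0_linear _ _ _)).
rewrite (linear_mapB (@c1_linear _ _ _)) c0_kpair c1_kpair subrr subr0;
  split=> //.
by apply: submodule0; apply: submodule_kchain.
Qed.

Lemma hlen_le_cone0 d (x : 'I_d.+1 -> R) L N k :
  submodule L -> submodule N -> L `<=` N ->
  hlen_le (tail x) 0 N L k -> hlen_le x 0 N L k.
Proof.
move=> sL sN LN; apply: cone_surj => //; first exact: submodule_kcyc.
  move=> f [/(kchainE _ _ sN)[_ f1] _]; exists 0.
    by apply: submodule0; apply: submodule_kchain.
  by rewrite (linear_map0 (koszul_d_linear _)) subr0.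
move=> f [Nf _]; rewrite kcyc0 //; apply/(kchainE _ _ sN).
by rewrite c0_kpair c1_kpair.
Qed.

(** The long exact sequence of the cone at H_(i+1)(x): the cofactor maps it to H_i of the tail, and
    [Bmid] represents the kernel, which comes from H_(i+1) of the tail. *)
Lemma hlen_le_coneS d (x : 'I_d.+1 -> R) i L N k l :
  submodule L -> submodule N -> L `<=` N ->
  hlen_le (tail x) i.+1 N L k -> hlen_le (tail x) i N L l ->
  hlen_le x i.+1 N L (k + l).
Proof.
move=> sL sN LN Hk Hl.
have sB := submodule_kbound (tail x) i sN sL.
pose Bmid := kcyc x i.+1 N L `&` (@c1 _ _ _ @^-1` kbound (tail x) i N L).
have sBmid : submodule Bmid.
  apply: submoduleI; first exact: submodule_kcyc.
  exact: (submodule_preimage (@c1_linear _ _ _)).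
have sZ := submodule_kcyc x i.+1 sN sL.
have c1_cyc f : kcyc x i.+1 N L f -> kcyc (tail x) i N L (c1 f).
  move=> [/(kchainE _ _ sN)[_ Nf] Lf]; split=> // J.
  have := Lf (ord0 |: lift ord0 @: J); rewrite -c1E c1_koszul_d ffun_oppE.
  by move/(submoduleN sL); rewrite opprK.
apply: (@len_leD _ _ _ Bmid) => //; first exact: submodule_kbound.
- move=> f Bf; split; first exact: kbound_kcyc Bf.
  case: Bf => _ [g /(kchainE _ _ sN)[_ Ng] <-] /(kchainE _ _ sL)[_ Lfg].
  exists (koszul_d (tail x) (- c1 g)).
    by exists (- c1 g) => //; apply: submoduleN => //; apply: submodule_kchain.
  rewrite (linear_mapN (koszul_d_linear _)) -c1_koszul_d.
  by rewrite -(linear_mapB (@c1_linear _ _ _)).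
- by move=> f [].
- apply: (cone_surj _ _ _ _ _ _ _ Hk) => //; first by move=> f [].
    move=> f [_ [_ [g Ng <-] Lfg]]; exists (kpair 0 (- g)).
      apply/(kchainE _ _ sN); rewrite c0_kpair c1_kpair; split.
        by apply: submodule0; apply: submodule_kchain.
      by apply: submoduleN => //; apply: submodule_kchain.
    rewrite (linear_mapB (@c1_linear _ _ _)) c1_koszul_d c1_kpair.
    by rewrite (linear_mapN (koszul_d_linear _)) opprK.
  move=> f [Nf Lf]; split; last first.
    by rewrite /= c1_kpair; apply: submodule0.
  split; first apply/(kchainE _ _ sN).
    rewrite c0_kpair c1_kpair; split=> //.
    by apply: submodule0; apply: submodule_kchain.
  apply: (kchain_ind (T := fun f J => L (f J))) => J.
    by rewrite -c0E c0_koszul_d c0_kpair c1_kpair scaler0 addr0.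
  rewrite -c1E c1_koszul_d c1_kpair (linear_map0 (koszul_d_linear _)) oppr0.
  by rewrite ffunE; apply: submodule0.
apply: (len_le_inj (@c1_linear _ _ _) _ _ _ _ _ _ Hl) => //.
- exact: submodule_kcyc.
- by move=> _ [f /c1_cyc Zf <-].
- exact: kbound_kcyc.
Qed.

End KoszulHomology.

(** * Filtration by the powers of a regular element *)

Section ScaleFiltration.
Variables (R : comNzRingType) (V : lmodType R) (a : R) (L N : set V).
Hypotheses (sL : submodule L) (sN : submodule N) (LN : L `<=` N).
Hypothesis reg : forall v, N v -> L (a *: v) -> L v.

(** As [a] is regular on N / L, multiplication by [a] is an isomorphism from [N] modulo [F j] onto a
    N + L modulo [F j.+1]. *)
Let F j := addset (smul (a ^+ j) N) L.

Lemma submodule_smulD b : submodule (addset (smul b N) L).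
Proof. by apply: submodule_addset => //; apply: submodule_smul. Qed.

Lemma smulD_sub b : addset (smul b N) L `<=` N.
Proof. by apply: addset_sub => //; apply: smul_sub. Qed.

Lemma sub_smulD b : L `<=` addset (smul b N) L.
Proof. by apply: addsetr; apply: submodule_smul. Qed.

Lemma smulD_scale j v : F j v -> F j.+1 (a *: v).
Proof.
move=> [_ [u Nu <-] Lvu]; exists (a ^+ j.+1 *: u); first by exists u.
by rewrite exprS -scalerA -scalerBr; apply: submoduleZ.
Qed.

Lemma smulD_unscale j v : N v -> F j.+1 (a *: v) -> F j v.
Proof.
move=> Nv [_ [u Nu <-]]; rewrite exprS -scalerA -scalerBr => Lvu.
exists (a ^+ j *: u); first by exists u.
by apply: reg Lvu; apply: submoduleB => //; apply: submoduleZ.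
Qed.

Lemma smulDS_sub j : F j.+1 `<=` addset (smul a N) L.
Proof.
move=> v [_ [u Nu <-] Lvu]; exists (a ^+ j.+1 *: u) => //.
by exists (a ^+ j *: u); rewrite ?exprS ?scalerA //; apply: submoduleZ.
Qed.

Lemma kchain_scale_to d i (M P : set V) (g : {ffun {set 'I_d} -> V}) :
  (forall v, M v -> P (a *: v)) -> kchain i M g -> kchain i P (a *: g).
Proof.
move=> MP [gi Mg]; split=> J; rewrite ffun_scaleE; last exact: MP.
by move=> Ji; rewrite gi // scaler0.
Qed.

Lemma scale_N1 v : N v -> addset (smul a N) L (a *: v).
Proof. by move=> Nv; apply: addsetl => //; exists v. Qed.

Lemma hlen_le_scale d (y : 'I_d -> R) i j k :
  hlen_le y i N (F j) k -> hlen_le y i (addset (smul a N) L) (F j.+1) k.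
Proof.
have [sFj sF] := (submodule_smulD (a ^+ j), submodule_smulD (a ^+ j.+1)).
have sF1 := submodule_smulD a.
apply: (len_le_surj (@scale_linear _ _ a)).
- exact: submodule_kcyc.
- by apply: kbound_kcyc => //; apply: smulD_sub.
- move=> f [_ [g Ng <-] Ffg]; exists (koszul_d y (a *: g)).
    by exists (a *: g) => //; apply: kchain_scale_to Ng; apply: scale_N1.
  rewrite (linear_mapZ (koszul_d_linear y)) -scalerBr.
  exact: kchain_scale_to (@smulD_scale j) Ffg.
move=> w [F1w Fdw]; have [g Ng Lwg] := kchain_addset_smul sN sL F1w.
exists g; last by apply: kbound_val => //; apply: kchain_sub Lwg;
  apply: sub_smulD.
split=> // J; apply: smulD_unscale; first by case: Ng => _ /(koszul_d_val y sN).
rewrite -ffun_scaleE -(linear_mapZ (koszul_d_linear y)).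
apply: (submoduleBl sF (Fdw J)).
rewrite -ffun_oppE -ffun_addE -(linear_mapB (koszul_d_linear y)).
apply: sub_smulD.
by case: Lwg => _ /(koszul_d_val y sL).
Qed.

(** Passing from [F j] to [F j.+1] adds one copy of N / (a N + L) on top of a shifted copy of the
    previous quotient. *)
Lemma hlen_le_pow d (y : 'I_d -> R) i j k :
  hlen_le y i N (addset (smul a N) L) k -> hlen_le y i N (F j) (j * k).
Proof.
move=> Hk; elim: j => [|j IH].
  have -> : F 0 = N; last exact: hlen_le_id.
  apply/seteqP; split; first exact: smulD_sub.
  by move=> v Nv; apply: addsetl => //; exists v; rewrite ?scale1r.
rewrite mulSn addnC; apply: (hlen_leD _ _ sN (@smulDS_sub j) _ _ Hk).
- exact: submodule_smulD.
- exact: submodule_smulD.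
- exact: smulD_sub.
- exact: hlen_le_scale.
Qed.

Lemma hlen_ge0_scale d (y : 'I_d -> R) j k :
  hlen_ge y 0 N (F j) k -> hlen_ge y 0 (addset (smul a N) L) (F j.+1) k.
Proof.
have [sFj sF] := (submodule_smulD (a ^+ j), submodule_smulD (a ^+ j.+1)).
have sF1 := submodule_smulD a.
rewrite /hlen_ge !kcyc0 //.
apply: (len_ge_inj (@scale_linear _ _ a)).
- exact: submodule_kchain.
- exact: submodule_kbound.
- exact: submodule_kchain.
- by move=> _ [f Nf <-]; apply: kchain_scale_to Nf; apply: scale_N1.
- by apply: kbound_kchain => //; apply: smulDS_sub.
move=> v Nv [_ [g F1g <-] Fvg].
have [g' Ng' Lgg'] := kchain_addset_smul sN sL F1g.
have [u Nu Lu] := kchain_addset_smul sN sL Fvg.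
exists (koszul_d y g'); first by exists g'.
(* [e] is the error in writing [v] as a boundary plus an element of a ^ j N; [a *: e] lies in [L],
   hence so does [e]. *)
pose e := v - koszul_d y g' - a ^+ j *: u.
have Ne : kchain 0 N e.
  have sK := submodule_kchain d 0 sN.
  apply: submoduleB => //; last exact: submoduleZ.
  by apply: submoduleB => //; apply: kchain_d.
have Lae : kchain 0 L (a *: e).
  have -> : a *: e = (a *: v - koszul_d y g - a ^+ j.+1 *: u) + koszul_d y (g -
    a *: g').
    rewrite (linear_mapB (koszul_d_linear y)) (linear_mapZ (koszul_d_linear y)).
    by rewrite [RHS]addrAC addrA subrK exprS -scalerA !scalerBr addrAC.
  by apply: submoduleD => //; [exact: submodule_kchain|exact: kchain_d].
split=> [J Ji|J];
  first by case: Ng' (koszul_d_deg y (proj1 Ng')) Nv => _ _ dg [vi _];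
  rewrite ffun_addE ffun_oppE vi // dg // subrr.
rewrite -[_ J](subrK ((a ^+ j *: u) J)) -ffun_oppE -ffun_addE.
apply: submoduleD => //.
  apply: sub_smulD.
  by apply: reg; [case: Ne|have [_ /(_ J)] := Lae; rewrite ffun_scaleE].
by apply: addsetl => //; exists (u J); rewrite ?ffun_scaleE //; case: Nu.
Qed.

End ScaleFiltration.

(** * Noetherian modules and local rings *)

Lemma mem_gen_ideal (R : comNzRingType) n (x : 'I_n -> R) i : gen_ideal x (x i).
Proof.
exists (fun j => (j == i)%:R).
rewrite (bigD1 i) //= eqxx scale1r big1 ?addr0 // => j /negbTE->.
by rewrite scale0r.
Qed.

Section Noetherian.
Variables (R : comNzRingType) (V : lmodType R).
Implicit Types (N P : set V) (s : seq V).

(** A list version of [lin_span], suited to induction on the generators. *)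
Fixpoint span s : set V :=
  if s is e :: s' then [set v | exists a, span s' (v - a *: e)] else [set 0].

Lemma submodule_span s : submodule (span s).
Proof.
elim: s => [|e s IH]; first exact: submodule_set0.
apply/submoduleP; split.
  by exists 0; rewrite scale0r subr0; apply: submodule0.
move=> a u v [b sb] [c sc]; exists (a * b + c).
rewrite scalerDl -scalerA opprD addrACA -scalerBr.
by apply: submoduleD => //; apply: submoduleZ.
Qed.

Lemma span_cons s e : span s `<=` span (e :: s).
Proof. by move=> v sv; exists 0; rewrite scale0r subr0. Qed.

Lemma mem_span s e : e \in s -> span s e.
Proof.
elim: s => // e' s IH; rewrite inE => /predU1P[->|/IH]; last exact: span_cons.
by exists 1; rewrite scale1r subrr; exact: (submodule0 (submodule_span s)).
Qed.

Lemma span_sub s N : submodule N -> (forall e, e \in s -> N e) -> span s `<=` N.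
Proof.
move=> sN; elim: s => [|e s IH] Ns v /=; first by move=> ->; apply: submodule0.
move=> [a sva]; have Nva : N (v - a *: e).
  by apply: IH sva => e' se'; apply: Ns; rewrite inE se' orbT.
exact: submoduleBr sN (submoduleZ a sN (Ns _ (mem_head _ _))) Nva.
Qed.

Lemma span_lin_span s : span s = lin_span (fun i : 'I_(size s) => s`_i).
Proof.
elim: s => [|e s IH].
  apply/seteqP; split=> [v ->|v [c]]; last by rewrite big_ord0.
  by exists (fun=> 0); rewrite big_ord0.
apply/seteqP; split=> v /=.
  move=> [a]; rewrite IH => -[c cE].
  exists (fun i => if unlift ord0 i is Some j then c j else a).
  rewrite big_ord_recl unlift_none /= -[v](subrK (a *: e)) cE addrC.
  by congr (_ + _); apply: eq_bigr => i _; rewrite liftK.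
move=> [c ->]; exists (c ord0); rewrite big_ord_recl /= addrC addKr IH.
by exists (fun i => c (lift ord0 i)).
Qed.

Lemma lin_span_span_size n (e : 'I_n -> V) :
  exists2 s, size s = n & lin_span e = span s.
Proof.
elim: n e => [|n IH] e.
  exists [::] => //; apply/seteqP; split=> [v [c]|v ->];
    first by rewrite big_ord0.
  by exists (fun=> 0); rewrite big_ord0.
have [s sn es] := IH (fun i => e (lift ord0 i)).
exists (e ord0 :: s); first by rewrite /= sn.
apply/seteqP; split=> v /=; rewrite -es.
  move=> [c ->]; exists (c ord0); rewrite big_ord_recl addrC addKr.
  by exists (fun i => c (lift ord0 i)).
move=> [a [c cE]]; exists (fun i => if unlift ord0 i is Some j then c j else a).
rewrite big_ord_recl unlift_none -[v](subrK (a *: e ord0)) cE addrC.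
by congr (_ + _); apply: eq_bigr => i _; rewrite liftK.
Qed.

Lemma lin_span_span n (e : 'I_n -> V) : exists s, lin_span e = span s.
Proof. by have [s _ es] := lin_span_span_size e; exists s. Qed.

Lemma fin_genP : fin_gen V <-> exists s, span s = setT.
Proof.
split=> [[n [e]]|[s]].
  by have [s ->] := lin_span_span e; exists s.
by rewrite span_lin_span; exists (size s), (fun i => s`_i).
Qed.

Definition noetherian_mod : Prop :=
  forall N, submodule N -> exists s, N = span s.

(** Without a maximal element, choice yields a strictly increasing sequence in [F]; its union is
    finitely generated, and the generators already lie in one term. *)
Lemma noetherian_max (F : set (set V)) : noetherian_mod ->
  (exists N, F N) -> (forall N, F N -> submodule N) ->
  exists2 N, F N & forall P, F P -> N `<=` P -> P = N.
Proof.
move=> noeth [N0 FN0] Fsub; apply: contrapT => nomax.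
have step (N : {N | F N}) : exists P : {N | F N}, sval N `<` sval P.
  apply: contrapT => noP; apply: nomax; exists (sval N); first exact: svalP.
  move=> P FP NP; have [//|NltP] := sub_proper_or_eq NP.
  by case: noP; exists (exist _ P FP).
have [g gP] := choice step.
pose C := fix C k := if k is k'.+1 then g (C k') else exist _ N0 FN0.
have CS k : sval (C k) `<` sval (C k.+1) by apply: gP.
have Cmono k l : (k <= l)%N -> sval (C k) `<=` sval (C l).
  move=> /subnK <-; elim: (l - k)%N => // j IH.
  exact: subset_trans IH (properW (CS _)).
have sC k : submodule (sval (C k)) by apply/Fsub/svalP.
pose U := [set v | exists k, sval (C k) v].
have sU : submodule U.
  apply/submoduleP; split; first by exists 0%N; apply: submodule0.
  move=> a u v [k Cu] [l Cv]; exists (maxn k l); apply: submoduleD => //.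
    by apply: submoduleZ => //; apply: Cmono Cu; apply: leq_maxl.
  by apply: Cmono Cv; apply: leq_maxr.
have [s Us] := noeth U sU.
have [k sk] : exists k, forall e, e \in s -> sval (C k) e.
  have : forall e, e \in s -> U e by move=> e; rewrite Us; apply: mem_span.
  elim: (s) => [|e s' IH] Us'; first by exists 0%N.
  have [k sk] := IH (fun e' se' => Us' e' (mem_behead (s := e :: s') se')).
  have [l Cl] := Us' e (mem_head _ _); exists (maxn k l) => e'.
  rewrite inE => /predU1P[->|/sk]; first by apply: Cmono Cl; apply: leq_maxr.
  by apply: Cmono; apply: leq_maxl.
have [_] := CS k; apply; apply: subset_trans (span_sub (sC k) sk).
by rewrite -Us => v Cv; exists k.+1.
Qed.

Lemma noetherian_stable (C : nat -> set V) : noetherian_mod ->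
  (forall k, submodule (C k)) -> (forall k, C k `<=` C k.+1) ->
  exists k, C k.+1 = C k.
Proof.
move=> noeth sC CS.
have [||N [k _ <-] kmax] := @noetherian_max (range C) noeth.
- by exists (C 0%N), 0%N.
- by move=> _ [k _ <-].
by exists k; apply: kmax; [exists k.+1|exact: CS].
Qed.

Lemma span_cat s1 s2 u v : span s1 u -> span s2 v -> span (s1 ++ s2) (u + v).
Proof.
elim: s1 u => [|e s IH] u /=; first by move=> -> sv; rewrite add0r.
by move=> [a su] sv; exists a; rewrite addrAC; apply: IH.
Qed.

(** Induction on the generators: the coefficients of [e] in elements of [N] form an ideal [I]. Lifts
    of generators of [I], with generators of the part of [N] inside [span s], generate [N]. *)
Lemma submodule_span_fg s N : noetherian R -> submodule N -> N `<=` span s ->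
  exists t, N = span t.
Proof.
move=> noeth; elim: s N => [|e s IH] N sN Ns.
  exists [::]; apply/seteqP; split=> // v /= ->; exact: submodule0.
pose I : set R^o := [set a | exists2 v, N v & span s (v - a *: e)].
have sI : submodule I.
  apply/submoduleP; split.
    by exists 0; rewrite ?scale0r ?subr0; apply: submodule0 => //;
      apply: submodule_span.
  move=> a b c [u Nu su] [v Nv sv]; exists (a *: u + v).
    by apply: submoduleD => //; apply: submoduleZ.
  have -> : a *: u + v - (a *: b + c) *: e = a *: (u - b *: e) + (v - c *: e).
    by rewrite scalerDl -scalerA opprD addrACA scalerBr.
  have ss := submodule_span s.
  by apply: submoduleD => //; apply: submoduleZ.
have [n [x Ix]] := noeth I sI.
have /choice[w wP] : forall i, exists v, N v /\ span s (v - x i *: e).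
  move=> i; have [v Nv sv] : I (x i); last by exists v.
  by rewrite Ix; apply: mem_gen_ideal.
have [t wt] := lin_span_span w.
have [u Nsu] : exists u, N `&` span s = span u.
  by apply: IH => [|v []//]; apply: submoduleI => //; apply: submodule_span.
exists (t ++ u); apply/seteqP; split=> v.
  move=> Nv; have [a sva] := Ns v Nv.
  have [c aE] : gen_ideal x a by rewrite -Ix; exists v.
  have {}aE : a = \sum_(i < n) c i * x i := aE.
  pose v' := \sum_(i < n) c i *: w i.
  have Nv' : N v'.
    by apply: submodule_sum => // i _; apply: submoduleZ => //; case: (wP i).
  rewrite -[v](subrKC v'); apply: span_cat; first by rewrite -wt; exists c.
  rewrite -Nsu; split; first exact: submoduleB.
  have -> : v - v' = (v - a *: e) - \sum_(i < n) c i *: (w i - x i *: e).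
    rewrite (eq_bigr (fun i => c i *: w i - (c i * x i) *: e)); last first.
      by move=> i _; rewrite scalerBr scalerA.
    by rewrite sumrB -scaler_suml -aE opprB addrA subrK.
  have ss := submodule_span s; apply: submoduleB => //.
  by apply: submodule_sum => // i _; apply: submoduleZ => //; case: (wP i).
apply: span_sub => // e'; rewrite mem_cat => /orP[/mem_span|/mem_span].
  rewrite -wt => -[c ->]; apply: submodule_sum => // i _.
  by apply: submoduleZ => //; case: (wP i).
by rewrite -Nsu => -[].
Qed.

Lemma fin_gen_noetherian : noetherian R -> fin_gen V -> noetherian_mod.
Proof.
by move=> noeth /fin_genP[s sT] N sN;
  apply: (submodule_span_fg noeth sN (s := s)); rewrite sT.
Qed.

End Noetherian.

Lemma gen_ideal_ideal (R : comNzRingType) n (x : 'I_n -> R) : ideal (gen_ideal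
  x).
Proof.
have [s sE] := lin_span_span (x : 'I_n -> R^o).
by rewrite /ideal /gen_ideal sE; apply: submodule_span.
Qed.

Section LocalRing.
Variables (R : comNzRingType) (m : set R).
Hypothesis m_local : local_ring m.

Lemma local_ideal : submodule (m : set R^o).
Proof. by case: m_local => _ []. Qed.

Lemma local_noetherian : noetherian_mod R^o.
Proof.
case: m_local => noeth _ _ I sI; have [n [x ->]] := noeth I sI.
exact: lin_span_span.
Qed.

(** An ideal maximal among the proper ideals above [I] exists by the Noetherian property, and it
    must be [m]. *)
Lemma proper_sub_local (I : set R) : ideal I -> ~ I 1 -> I `<=` m.
Proof.
move=> sI I1; have [||N [sN N1 IN] Nmax] := noetherian_max
  (F := fun J : set R^o => [/\ ideal J, ~ J 1 & I `<=` J]) local_noetherian.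
- by exists I; split.
- by move=> J [].
case: m_local => _ _ uniq; rewrite -(uniq N) //; split=> // [NT|J sJ NJ];
  first by apply: N1; rewrite NT.
have [J1|J1] := pselect (J 1); last first.
  by left; apply: Nmax => //; split=> //; apply: subset_trans NJ.
right; apply/seteqP; split=> // r _; rewrite -[r]mulr1.
exact: (submoduleZ (V := R^o) r sJ J1).
Qed.

Lemma local_notin1 : ~ m 1.
Proof.
case: m_local => _ [sm mT _] _ m1; apply: mT; apply/seteqP; split=> // r _.
by rewrite -[r]mulr1; exact: (submoduleZ (V := R^o) r sm m1).
Qed.

Lemma local_unit r : ~ m r -> exists s, s * r = 1.
Proof.
move=> mr; apply: contrapT => nos; apply: mr.
apply: (@proper_sub_local (cyclic_span (r : R^o))).
- exact: submodule_cyclic.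
- by move=> [s rE]; apply: nos; exists s.
- exact: cyclic_span_id.
Qed.

Variable V : lmodType R.
Implicit Types L N P : set V.

Lemma len_le_simple P v : submodule P -> (forall a, m a -> P (a *: v)) ->
  len_le P (addset P (cyclic_span v)) 1.
Proof.
move=> sP Pmv [C [sC [D [sD PD [DC CD]]] [CP PC]]]; apply: PC.
have PsubC : P `<=` C by apply: subset_trans DC.
apply: addset_sub => //; apply: cyclic_span_sub => //.
apply: contrapT => Cv; apply: CD => c Cc; apply: PD.
have [p Pp [a ca]] := CP _ Cc.
have [ma|/local_unit[s sa]] := pselect (m a).
  by rewrite -[c](subrKC p) ca; apply: submoduleD => //; apply: Pmv.
case: Cv; rewrite -[v]scale1r -sa -scalerA -ca; apply: submoduleZ => //.
by apply: submoduleB => //; apply: PsubC.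
Qed.

(** For each [r] in turn, [u] is multiplied by the largest power of [r] that keeps it outside
    [P]. *)
Lemma exists_socle P N v (t : seq R) : submodule P -> submodule N -> N v -> ~ P
  v ->
  (forall r, r \in t -> exists k, forall u, N u -> P (r ^+ k *: u)) ->
  exists2 u, N u & ~ P u /\ forall r, r \in t -> P (r *: u).
Proof.
move=> sP sN Nv Pv; elim: t => [|r t IH] tP; first by exists v.
have [|u Nu [Pu tu]] := IH; first by move=> s st; apply: tP;
  rewrite inE st orbT.
have [k Pk] := tP r (mem_head _ _).
have exk : exists k, `[< P (r ^+ k *: u) >] by exists k; apply/asboolP/Pk.
case: (ex_minnP exk) => [[|j]] /asboolP Pj jmin; first by rewrite scale1r in Pj.
exists (r ^+ j *: u); first exact: submoduleZ.
split=> [/asboolP/jmin|s]; first by rewrite ltnn.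
rewrite inE => /predU1P[->|/tu Psu]; first by rewrite scalerA -exprS.
by rewrite scalerA mulrC -scalerA; apply: submoduleZ.
Qed.

(** Take [P] maximal with P / L of finite length. If [P] were not [N], an element of [N] outside [P]
    that [m] carries into [P] would enlarge [P] by length at most 1. *)
Lemma finite_length L N : noetherian_mod V -> submodule L -> submodule N ->
  L `<=` N -> (forall r, m r -> exists k, forall v, N v -> L (r ^+ k *: v)) ->
  exists C, len_le L N C.
Proof.
move=> noeth sL sN LN nilp; have [t mt] := local_noetherian local_ideal.
have [||P [sP LP PN [C LPC]] Pmax] := noetherian_max
  (F := fun P => [/\ submodule P, L `<=` P, P `<=` N & exists C, len_le L P C])
    noeth.
- by exists L; split=> //; exists 0%N; apply: len_le_id.
- by move=> P [].
have [NP|NP] := pselect (N `<=` P).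
  by exists C; have -> : N = P by apply/seteqP.
have [v Nv Pv] : exists2 v, N v & ~ P v.
  apply: contrapT => nov; apply: NP => v Nv; apply: contrapT => Pv.
  by apply: nov; exists v.
have [|u Nu [Pu tu]] := exists_socle (t := t) sP sN Nv Pv.
  move=> r tr; have mr : m r by rewrite mt; apply: mem_span.
  by have [k Lk] := nilp r mr; exists k => w /Lk /LP.
have Pmu r : m r -> P (r *: u).
  pose Q : set R^o := [set r : R^o | P (r *: u)].
  have sQ : submodule Q.
    apply/submoduleP; split; first by rewrite /Q /= scale0r; apply: submodule0.
    move=> a b c Qb Qc; rewrite /Q /= scalerDl -scalerA.
    by apply: submoduleD => //; apply: submoduleZ.
  by rewrite mt; apply: (span_sub sQ).
have su := submodule_cyclic u.
pose P' := addset P (cyclic_span u).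
have sP' : submodule P' by apply: submodule_addset.
have PP' : P `<=` P' by apply: addsetl.
case: Pu; rewrite -(Pmax P') //; first by apply: addsetr => //;
  apply: cyclic_span_id.
split=> //; first exact: subset_trans PP'.
  by apply: addset_sub => //; apply: cyclic_span_sub.
exists (C + 1)%N; apply: (@len_leD _ _ _ P) => //.
exact: len_le_simple.
Qed.

End LocalRing.

(** * Growth of Koszul homology of powers *)

Section KoszulGrowth.
Variables (R : comNzRingType) (m : set R).
Hypothesis m_local : local_ring m.
Variable V : lmodType R.
Hypothesis V_noetherian : noetherian_mod V.
Implicit Types L N P : set V.

(* Every element of m has a power in (x) + Ann (N / L), that is, N / (x N + L)
   is killed by a power of m. *)
Definition is_sop_on d (x : 'I_d -> R) L N : Prop :=
  forall r, m r -> exists k c, gen_ideal x c /\ forall v, N v -> L ((r ^+ k -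
    c) *: v).

Lemma is_sop_on_sub d (x : 'I_d -> R) L L' N N' :
  L `<=` L' -> N' `<=` N -> is_sop_on x L N -> is_sop_on x L' N'.
Proof.
move=> LL NN sop r /sop[k [c [xc Lc]]]; exists k, c; split=> // v /NN /Lc.
exact: LL.
Qed.

Lemma is_sop_on_tail d (x : 'I_d.+1 -> R) L N : submodule L ->
  (forall v, N v -> L (x ord0 *: v)) -> is_sop_on x L N -> is_sop_on (tail x) L
    N.
Proof.
move=> sL Lx0 sop r /sop[k [_ [[c ->] Lc]]].
exists k, (\sum_(i < d) c (lift ord0 i) *: (x (lift ord0 i) : R^o)); split.
  by exists (fun i => c (lift ord0 i)).
move=> v Nv; have := Lc v Nv; rewrite big_ord_recl opprD addrA addrAC.
rewrite -[c ord0 *: _]/(c ord0 * x ord0) [X in L X -> _]scalerBl -scalerA.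
move=> Ld; have Lxv := submoduleZ (c ord0) sL (Lx0 v Nv).
rewrite -[X in L X](subrK (c ord0 *: (x ord0 *: v))).
exact: submoduleD.
Qed.

(* For i > 0 the exponent of n is one less than for i = 0. *)
Definition koszul_growth d (x : 'I_d -> R) i N L : Prop :=
  exists C, forall n, (0 < n)%N -> exists2 k,
    hlen_le (fun j => x j ^+ n) i N L k & (n ^ (0 < i) * k <= C * n ^ d)%N.

Lemma koszul_growthD d (x : 'I_d -> R) i L N P :
  submodule L -> submodule N -> submodule P -> L `<=` N -> N `<=` P ->
  koszul_growth x i N L -> koszul_growth x i P N -> koszul_growth x i P L.
Proof.
move=> sL sN sP LN NP [C HC] [D HD]; exists (C + D)%N => n n0.
have [[k Nk kC] [l Pl lD]] := (HC n n0, HD n n0).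
exists (k + l)%N; first exact: hlen_leD Nk Pl.
by rewrite mulnDr mulnDl leq_add.
Qed.

Lemma koszul_growth_empty (x : 'I_0 -> R) i L N :
  submodule L -> submodule N -> L `<=` N -> is_sop_on x L N ->
  koszul_growth x i N L.
Proof.
move=> sL sN LN sop; case: i => [|i].
  have [|C NC] := finite_length m_local V_noetherian sL sN LN.
    move=> r /sop[k [_ [[c ->] Lr]]]; exists k => v /Lr.
    by rewrite big_ord0 subr0.
  exists C => n _; exists C; last by rewrite !expn0 mul1n muln1.
  pose ev (f : {ffun {set 'I_0} -> V}) := f (finset.set0 : {set 'I_0}).
  have ev_lin : linear ev by move=> a f g; rewrite /ev !ffunE.
  apply: (len_le_inj ev_lin _ _ _ _ _ _ NC) => //.
  - exact: submodule_kcyc.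
  - by move=> _ [f [[_ Nf] _] <-]; apply: Nf.
  move=> f [[f0 Nf] _] Lf; apply: kbound_val => //; split=> // J.
  have -> // : J = finset.set0 by apply/setP => -[].
exists 0%N => n _; exists 0%N; last by rewrite muln0.
move=> [C [sC _ [_]]]; apply=> f [[fi _] _].
have -> : f = 0; last exact: submodule0.
apply/ffunP => J; rewrite fi ?ffunE //.
by have := max_card J; rewrite card_ord leqn0 => /eqP->.
Qed.

Section Step.
Variable d : nat.
Hypothesis IH : forall (x : 'I_d -> R) i L N,
  submodule L -> submodule N -> L `<=` N -> is_sop_on x L N -> koszul_growth x
    i N L.

(** As x_0 kills N / L, the tail still satisfies [is_sop_on] there, so induction applies to it. *)
Lemma koszul_growth_killed (x : 'I_d.+1 -> R) i L N :
  submodule L -> submodule N -> L `<=` N -> is_sop_on x L N ->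
  (forall v, N v -> L (x ord0 *: v)) -> koszul_growth x i N L.
Proof.
move=> sL sN LN sop Lx0; have sop' := is_sop_on_tail sL Lx0 sop.
case: i => [|i].
  have [C HC] := IH 0 sL sN LN sop'; exists C => n n0.
  have [k Nk kC] := HC n n0; exists k; first exact: hlen_le_cone0.
  by rewrite expnS; apply: leq_trans kC _; rewrite leq_mul2l leq_pmull ?orbT.
have [[C HC] [D HD]] := (IH i.+1 sL sN LN sop', IH i sL sN LN sop').
exists (C + D)%N => n n0; have [[k Nk kC] [l Nl lD]] := (HC n n0, HD n n0).
exists (k + l)%N; first exact: hlen_le_coneS.
rewrite mulnDr mulnDl leq_add //.
  by apply: leq_trans kC _; rewrite expnS leq_mul2l leq_pmull ?orbT.
(* The additional parameter supplies a factor [n], so order n ^ d suffices for [l], even for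
   [i = 0], when [l] bounds an H_0. *)
rewrite expn1 expnS mulnCA leq_mul2l; apply/orP; right.
by apply: leq_trans lD; rewrite leq_pmull // expn_gt0 n0.
Qed.

Lemma koszul_growth_regular (x : 'I_d.+1 -> R) i L N :
  submodule L -> submodule N -> L `<=` N -> is_sop_on x L N ->
  (forall v, N v -> L (x ord0 *: v) -> L v) -> koszul_growth x i N L.
Proof.
move=> sL sN LN sop reg; set a := x ord0 in reg.
have saN := submodule_smul a sN.
have saNL := submodule_addset saN sL.
have LaNL : L `<=` addset (smul a N) L by apply: addsetr.
have [||C HC] := IH (x := tail x) i saNL sN.
- exact: smulD_sub.
- apply: is_sop_on_tail => //; last exact: is_sop_on_sub sop.
  by move=> v Nv; apply: addsetl => //; exists v.
exists C => n n0; have [k Nk kC] := HC n n0; exists (n * k)%N; last first.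
  by rewrite expnS !(mulnCA _ n) leq_mul2l kC orbT.
have regX j v : N v -> L (a ^+ j *: v) -> L v.
  elim: j v => [|j IHj] v Nv; first by rewrite scale1r.
  rewrite exprSr -scalerA => /IHj Lav; apply: reg => //.
  by apply: Lav; apply: submoduleZ.
apply: hlen_le_regular => //; first exact: regX.
exact: hlen_le_pow.
Qed.

(** [T j] is the part of [N] that a ^ j carries into [L]. Once the chain is stationary at [K], [a]
    is regular on N / T K, while it kills every T (j + 1) / T j. *)
Lemma koszul_growth_step (x : 'I_d.+1 -> R) i L N :
  submodule L -> submodule N -> L `<=` N -> is_sop_on x L N ->
  koszul_growth x i N L.
Proof.
move=> sL sN LN sop; set a := x ord0.
pose T j : set V := [set v | N v /\ L (a ^+ j *: v)].
have sT j : submodule (T j).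
  exact: submoduleI (submodule_preimage (scale_linear (a ^+ j)) sL).
have TS j : T j `<=` T j.+1.
  by move=> v [Nv Lv]; split=> //; rewrite exprS -scalerA; apply: submoduleZ.
have [K TK] := noetherian_stable V_noetherian sT TS.
have LT j : L `<=` T j.
  by move=> v Lv; split; [apply: LN|apply: submoduleZ].
have TN j : T j `<=` N by move=> v [].
apply: (@koszul_growthD _ _ _ _ (T K)) => //; last first.
  apply: koszul_growth_regular => //; first exact: is_sop_on_sub sop.
  move=> v Nv [_ Lv]; rewrite -TK; split=> //.
  by rewrite exprSr -scalerA.
elim: K {TK} => [|K IHK].
  have -> : T 0%N = L.
    apply/seteqP; split=> [v [_]|]; last exact: LT.
    by rewrite scale1r.
  by exists 0%N => n _; exists 0%N; rewrite ?muln0 //; apply: hlen_le_id.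
apply: koszul_growthD IHK _ => //.
apply: koszul_growth_killed => //; first exact: is_sop_on_sub sop.
move=> v [Nv Lv]; split; first exact: submoduleZ.
by rewrite scalerA -exprSr.
Qed.

End Step.

Theorem koszul_growth_sop d (x : 'I_d -> R) i L N :
  submodule L -> submodule N -> L `<=` N -> is_sop_on x L N ->
  koszul_growth x i N L.
Proof.
elim: d x i L N => [|d IH] x i L N; first exact: koszul_growth_empty.
exact: koszul_growth_step.
Qed.

End KoszulGrowth.

(** * Lower bound for the zeroth Koszul homology *)

Lemma prime_idealP (R : comNzRingType) (P : set R) a b :
  prime_ideal P -> P (a * b) -> P a \/ P b.
Proof.
move=> [_ _ Pprime] Pab; have /orP[] := Pprime a b (mem_set Pab).
  by move/set_mem; left.
by move/set_mem; right.
Qed.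

Lemma prime_ideal_submodule (R : comNzRingType) (P : set R) :
  prime_ideal P -> submodule (P : set R^o).
Proof. by case. Qed.

Lemma prime_ideal1 (R : comNzRingType) (P : set R) : prime_ideal P -> ~ P 1.
Proof.
move=> [sP PT _] P1; apply: PT; apply/seteqP; split=> // r _; rewrite -[r]mulr1.
exact: (submoduleZ (V := R^o) r sP P1).
Qed.

(** Here k >= e / A and l <= C e / n; once n >= 2 A C, [l] is at most half of e / A. This is the
    source of the factor 2 A and of the threshold 2 A C in both lower bounds. *)
Lemma leq_subr_absorb A C n e k l : (0 < n)%N -> (2 * A * C <= n)%N ->
  (n * l <= C * e)%N -> (e <= A * k)%N -> (e <= 2 * A * (k - l))%N.
Proof.
move=> n0 nAC nl ek.
have : (n * (2 * A * l) <= n * e)%N.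
  rewrite mulnCA; apply: (@leq_trans (2 * A * (C * e)));
    first by rewrite leq_mul2l nl orbT.
  by rewrite mulnA leq_mul2r nAC orbT.
rewrite leq_pmul2l // => Al; rewrite mulnBr; lia.
Qed.

Section LowerBound.
Variables (R : comNzRingType) (m : set R).
Hypothesis m_local : local_ring m.

Lemma hlen_ge0_mono (V : lmodType R) d (x : 'I_d -> R) (N L L' : set V) k :
  submodule L -> submodule L' -> L `<=` L' ->
  hlen_ge x 0 N L' k -> hlen_ge x 0 N L k.
Proof.
move=> sL sL' LL; rewrite /hlen_ge !kcyc0 //.
by apply: len_ge_mono => //; apply: kbound_mono.
Qed.

(** The induction drops [P 0]: since x_0 lies in [P 1], R / (P_0 + x_0 R) maps onto R / P_1, to
    which the tail and the shifted chain of primes apply. *)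
Lemma koszul_lower_prime d (x : 'I_d -> R) (P : nat -> set R) :
  (forall i, (i <= d)%N -> prime_ideal (P i)) ->
  (forall i, (i < d)%N -> P i `<=` P i.+1) ->
  (forall j : 'I_d, ~ P j (x j) /\ P j.+1 (x j)) ->
  is_sop_on m x (P 0%N : set R^o) setT ->
  exists A n0, forall n, (n0 <= n)%N -> exists2 k,
    hlen_ge (fun j => x j ^+ n) 0 (setT : set R^o) (P 0%N : set R^o) k
    & (n ^ d <= A * k)%N.
Proof.
elim: d x P => [|d IH] x P Pprime Pchain Px sop.
  have P0 := Pprime 0%N (leqnn _); have sP0 := prime_ideal_submodule P0.
  exists 1%N, 0%N => n _; exists 1%N => //; rewrite /hlen_ge kcyc0 //.
  have sT := @submoduleT _ (R^o : lmodType R).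
  apply: len_ge1; first exact: submodule_kbound.
  split; first exact: kbound_kchain.
  (* With no parameters H_0 is R / P_0, of length at least 1 because 1 is not in [P 0]. *)
  pose e : {ffun {set 'I_0} -> R^o} := [ffun=> 1].
  move=> /(_ e)[|_ [g [_ _] <-] [_ /(_ finset.set0)]].
    split=> // J; rewrite ffunE.
    by have := max_card J; rewrite card_ord leqn0 => /eqP->.
  rewrite !ffunE big_ord0 subr0; exact: prime_ideal1.
have [P0 P1] := (Pprime 0%N (leq0n _), Pprime 1%N isT).
have [sP0 sP1] := (prime_ideal_submodule P0, prime_ideal_submodule P1).
have sT := @submoduleT _ (R^o : lmodType R).
set a := x ord0; have [P0a P1a] := Px ord0.
have reg (v : R^o) : setT v -> (P 0%N : set R^o) (a *: v) -> (P 0%N : set R^o)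
  v.
  by move=> _ /(prime_idealP P0)[].
have P01 : P 0%N `<=` P 1%N by apply: Pchain.
pose F j : set R^o := addset (smul (a ^+ j) setT) (P 0%N : set R^o).
have sF j : submodule (F j) by apply: submodule_smulD.
pose F1 : set R^o := addset (smul a setT) (P 0%N : set R^o).
have sF1 : submodule F1 by apply: submodule_smulD.
have F1P : F1 `<=` P 1%N.
  apply: addset_sub => // _ [v _ <-]; rewrite [_ *: _]mulrC.
  exact: (submoduleZ (V := R^o)).
have F1kill (v : R^o) : setT v -> F1 (a *: v).
  by move=> _; apply: addsetl => //; exists v.
have soptail : is_sop_on m (tail x) F1 setT.
  apply: is_sop_on_tail => //; apply: is_sop_on_sub sop => //.
  by apply: sub_smulD.
have [||||A [n0 HA]] := IH (tail x) (fun i => P i.+1).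
- by move=> i id; apply: Pprime.
- by move=> i id; apply: Pchain.
- by move=> j; have := Px (lift ord0 j).
- exact: is_sop_on_sub soptail.
have [C HC] := koszul_growth_sop m_local (local_noetherian m_local) 1 sF1 sT
  (@subsetT _ _) soptail.
exists (2 * A)%N, (maxn (maxn 1 n0) (2 * A * C)) => n; rewrite !geq_max.
move=> /andP[/andP[n_gt0 /HA[k Nk kA]] /leq_subr_absorb nAC].
have [l Nl lC] := HC n n_gt0; rewrite expn1 in lC.
exists (n * (k - l))%N; last first.
  by rewrite mulnCA expnS leq_mul2l nAC ?orbT.
apply: hlen_ge0_tail => //.
have Nk1 : hlen_ge (fun j => tail x j ^+ n) 0 setT F1 k.
  exact: hlen_ge0_mono Nk.
suff H j : hlen_ge (fun i =>
  tail x i ^+ n) 0 setT (F j) (j * (k - l)) by exact: H.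
elim: j => [|j IHj]; first by rewrite /hlen_ge kcyc0 //; apply: kbound_kchain.
(* The copy of [R] modulo [F j] loses at most [l] to H_1, and [R] modulo [F1] contributes [k]. *)
apply: (@len_ge_leq _ _ _ _ _ (j * (k - l) - l + k)%N); first by nia.
apply: (hlen_ge0D _ sF1 sT _ _ _ Nl Nk1) => //; first exact: smulDS_sub.
exact: hlen_ge0_scale.
Qed.

(** If each generator were killed by an element outside [P], the product of these elements would
    kill [M] and yet lie outside [P]. The submodule generated by [v] then maps onto R / P. *)
Lemma exists_ann_sub (M : lmodType R) (P : set R) : fin_gen M -> prime_ideal P
  ->
  annihilator M `<=` P -> exists v : M, forall a, a *: v = 0 -> P a.
Proof.
move=> /fin_genP[s sT] Pprime annP; apply: contrapT => nov.
have kill (v : M) : exists a, a *: v = 0 /\ ~ P a.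
  apply: contrapT => noa; apply: nov; exists v => a av.
  by apply: contrapT => Pa; apply: noa; exists a.
have [b [bs Pb]] : exists b, (forall e, e \in s -> b *: e = 0) /\ ~ P b.
  elim: (s) => [|e s' [b [bs' Pb]]]; first by exists 1; split=> //;
    exact: prime_ideal1.
  have [a [ae Pa]] := kill e; exists (a * b); split; last first.
    by case/(prime_idealP Pprime).
  move=> e'; rewrite inE => /predU1P[->|/bs' be']; last first.
    by rewrite -scalerA be' scaler0.
  by rewrite mulrC -scalerA ae scaler0.
apply: Pb; apply: annP => v; have : (setT : set M) v by [].
have sK : submodule [set v : M | b *: v = 0].
  exact: (submodule_preimage (scale_linear b) (@submodule_set0 _ _)).
by rewrite -sT => /(span_sub sK bs).
Qed.

Lemma koszul_lower_module (M : lmodType R) d (x : 'I_d -> R) (P : nat -> set R)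
  :
  fin_gen M -> annihilator M `<=` P 0%N ->
  (forall i, (i <= d)%N -> prime_ideal (P i)) ->
  (forall i, (i < d)%N -> P i `<=` P i.+1) ->
  (forall j : 'I_d, ~ P j (x j) /\ P j.+1 (x j)) ->
  (forall r, m r -> exists k, gen_ideal x (r ^+ k)) ->
  exists A n0, forall n, (n0 <= n)%N -> exists2 k,
    hlen_ge (fun j => x j ^+ n) 0 (setT : set M) [set 0] k & (n ^ d <= A * k)%N.
Proof.
move=> Mfg annP Pprime Pchain Px sop.
have sop' (V : lmodType R) (L N : set V) : submodule L -> is_sop_on m x L N.
  move=> sL r /sop[k xk]; exists k, (r ^+ k); split=> // v _.
  by rewrite subrr scale0r; apply: submodule0.
have P0 := Pprime 0%N (leq0n _); have sP0 := prime_ideal_submodule P0.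
have [A [n0 HA]] := koszul_lower_prime Pprime Pchain Px (sop' _ _ _ sP0).
have noeth : noetherian_mod M by case: m_local => noeth _ _;
  apply: fin_gen_noetherian.
have [v vP] := exists_ann_sub Mfg P0 annP.
have sN := submodule_cyclic v; set N := cyclic_span v in sN.
have [sT s0] := (@submoduleT _ M, @submodule_set0 _ M).
have sTR := @submoduleT _ (R^o : lmodType R).
have [C HC] := koszul_growth_sop m_local noeth 1 sN sT (@subsetT _ _) (sop' _ N
  setT sN).
exists (2 * A)%N, (maxn (maxn 1 n0) (2 * A * C)) => n; rewrite !geq_max.
move=> /andP[/andP[n_gt0 /HA[k Nk kA]] /leq_subr_absorb nAC].
have [l Nl lC] := HC n n_gt0; rewrite expn1 in lC.
exists (k - l)%N; last exact: nAC.
have N0 : [set 0] `<=` N by move=> _ ->; apply: submodule0.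
rewrite -[(k - l)%N]addn0.
apply: (hlen_ge0D s0 sN sT N0 (@subsetT _ _) _ Nl); last first.
  exact: kbound_kcyc.
(* The surjection of [N] onto R / P_0 is used in the opposite direction, through [phi]: what [phi]
   sends to a boundary is a boundary modulo [P 0]. *)
pose phi (a : R^o) : M := a *: v.
have phi_lin : linear phi by move=> a b c; rewrite /phi scalerDl -scalerA.
have Nphi : N `<=` phi @` setT by move=> _ [a ->]; exists a.
have phiN : phi @` setT `<=` N by move=> _ [a _ <-]; exists a.
move: Nk; rewrite /hlen_ge !kcyc0 //;
  apply: (len_ge_inj (kmap_linear phi_lin (d := d))).
- exact: submodule_kchain.
- exact: submodule_kbound.
- exact: submodule_kchain.
- by move=> _ [f /(kchain_map phi_lin) Pf <-]; apply: kchain_sub Pf.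
- exact: kbound_kchain.
move=> f Tf [_ [g Ng <-] [_ h0]].
have [|||g' Tg' gE] := kchain_lift (N := setT) (Q := fun (a : R^o) (w : M) =>
  phi a = w) _ _ _ Ng.
- by [].
- exact: linear_map0.
- by move=> w /Nphi[a _ <-]; exists a.
exists (koszul_d (fun j => x j ^+ n) g'); first by exists g'.
have sK := submodule_kchain d 0 sTR.
have [fdeg _] := submoduleB sK Tf (kchain_d (fun j => x j ^+ n) sTR Tg').
split=> // J; apply: vP; rewrite -/(phi _).
have gE' : kmap phi g' = g by apply/ffunP => J'; rewrite ffunE.
have := h0 J; rewrite -gE' -(kmap_d phi_lin) -(linear_mapB (kmap_linear phi_lin
  (d := d))).
by rewrite ffunE.
Qed.

End LowerBound.

(** * Systems of parameters along a chain of primes *)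

Section Primes.
Variable R : comNzRingType.
Implicit Types (P Q I : set R) (s : seq (set R)).

Lemma prime_ideal_intro P : ideal P -> ~ P 1 ->
  (forall a b, P (a * b) -> P a \/ P b) -> prime_ideal P.
Proof.
move=> sP P1 Pab; split=> //; first by move=> PT; apply: P1; rewrite PT.
move=> a b /set_mem/Pab[/mem_set Pa|/mem_set Pb]; apply/orP; by [left|right].
Qed.

Lemma idealM P a b : ideal P -> P b -> P (a * b).
Proof. by move=> sP Pb; apply: (submoduleZ (V := R^o) a sP Pb). Qed.

Lemma idealMl P a b : ideal P -> P a -> P (a * b).
Proof. by move=> sP Pa; rewrite mulrC; apply: idealM. Qed.

Definition adjoin I a : set R := addset (I : set R^o) (cyclic_span (a : R^o)).

Lemma adjoin_ideal I a : ideal I -> ideal (adjoin I a).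
Proof. by move=> sI; apply: submodule_addset => //;
  apply: submodule_cyclic. Qed.

Lemma adjoin_sub I a : I `<=` adjoin I a.
Proof. exact: (@addsetl _ R^o I _ (submodule_cyclic _)). Qed.

Lemma mem_adjoin I a : ideal I -> adjoin I a a.
Proof. by move=> sI; apply: addsetr => //; apply: cyclic_span_id. Qed.

Lemma adjoin_min I a P : ideal P -> I `<=` P -> P a -> adjoin I a `<=` P.
Proof.
move=> sP IP Pa; apply: (@addset_sub _ R^o) => //.
exact: (@cyclic_span_sub _ R^o).
Qed.

Lemma adjoinM I a b u v : ideal I -> I (a * b) -> adjoin I a u -> adjoin I b v
  ->
  I (u * v).
Proof.
move=> sI Iab [u' Iu' [c ca]] [v' Iv' [e eb]].
rewrite -[u](subrKC u') ca -[v](subrKC v') eb mulrDl.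
apply: (submoduleD (V := R^o)) => //; first exact: idealMl.
rewrite mulrDr; apply: (submoduleD (V := R^o)) => //; first exact: idealM.
by rewrite -[c *: _]/(c * a) -[e *: _]/(e * b) mulrACA; apply: idealM.
Qed.

(** Noetherian induction: if a maximal counterexample contains a b but neither factor, every prime
    above it contains [a] or [b], so the lists for the two larger ideals can be joined. *)
Lemma finitely_many_primes I : noetherian_mod R^o -> ideal I ->
  exists s, (forall Q, Q \in s -> prime_ideal Q /\ I `<=` Q) /\
    forall Q, prime_ideal Q -> I `<=` Q -> exists2 Q', Q' \in s & Q' `<=` Q.
Proof.
move=> noeth; pose good I := exists s,
  (forall Q, Q \in s -> prime_ideal Q /\ I `<=` Q) /\
    forall Q, prime_ideal Q -> I `<=` Q -> exists2 Q', Q' \in s & Q' `<=` Q.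
move=> sI0; apply: contrapT => badI.
have [||J [sJ badJ] Jmax] := noetherian_max
  (F := fun J : set R^o => ideal J /\ ~ good J) noeth.
- by exists I.
- by move=> J [].
have goodS K : ideal K -> J `<=` K -> ~ (K `<=` J) -> good K.
  move=> sK JK KJ; apply: contrapT => badK; apply: KJ.
  by rewrite (Jmax K).
apply: badJ; have [J1|J1] := pselect (J 1).
  by exists [::]; split=> // Q Qprime JQ; case: (prime_ideal1 Qprime);
    apply: JQ.
have [Jprime|Jnprime] := pselect (prime_ideal J).
  exists [:: J]; split=> [Q|Q _ JQ]; first by rewrite inE => /eqP->; split.
  by exists J; rewrite ?inE.
have [a [b [Jab Ja Jb]]] : exists a b, [/\ J (a * b), ~ J a & ~ J b].
  apply: contrapT => noab; apply: Jnprime;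
    apply: prime_ideal_intro => // a b Jab.
  have [Ja|Ja] := pselect (J a); first by left.
  have [Jb|Jb] := pselect (J b); first by right.
  by case: noab; exists a, b.
have [s1 [s1P s1min]] : good (adjoin J a).
  apply: goodS; [exact: adjoin_ideal|exact: adjoin_sub|].
  by move=> /(_ a (mem_adjoin a sJ)) /Ja.
have [s2 [s2P s2min]] : good (adjoin J b).
  apply: goodS; [exact: adjoin_ideal|exact: adjoin_sub|].
  by move=> /(_ b (mem_adjoin b sJ)) /Jb.
exists (s1 ++ s2); split=> Q.
  rewrite mem_cat => /orP[/s1P|/s2P] [Qprime JQ]; split=> //;
    by apply: subset_trans JQ; apply: adjoin_sub.
move=> Qprime JQ; have sQ := prime_ideal_submodule Qprime.
have [Qa|Qb] := prime_idealP Qprime (JQ _ Jab).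
  have [Q' s1Q' Q'Q] := s1min Q Qprime (adjoin_min sQ JQ Qa).
  by exists Q'; rewrite // mem_cat s1Q'.
have [Q' s2Q' Q'Q] := s2min Q Qprime (adjoin_min sQ JQ Qb).
by exists Q'; rewrite // mem_cat s2Q' orbT.
Qed.

Lemma prime_avoidance s P : ideal P ->
  (forall Q, Q \in s -> prime_ideal Q /\ ~ (P `<=` Q)) ->
  exists2 x, P x & forall Q, Q \in s -> ~ Q x.
Proof.
move=> sP; have [n] := ubnP (size s); elim: n s => // n IH [|Q s] /=.
  by exists 0 => //; apply: (submodule0 (V := R^o)).
rewrite ltnS => sn sQ.
have [[Q' sQ' Q'Q]|noQ'] := pselect (exists2 Q', Q' \in s & Q' `<=` Q).
  have [||x Px xs] := IH (Q :: rem Q' s).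
  - rewrite /= size_rem // prednK //.
    by case: (s) sQ'.
  - move=> Q2; rewrite inE => /predU1P[->|/mem_rem sQ2].
      by apply: sQ; rewrite mem_head.
    by apply: sQ; rewrite inE sQ2 orbT.
  exists x => // Q2; rewrite inE => /predU1P[->|sQ2].
    by apply: xs; rewrite mem_head.
  have [->|Q2Q'] := eqVneq Q2 Q'; first by move/Q'Q; apply: xs;
    rewrite mem_head.
  apply: xs; rewrite inE; apply/orP; right.
  by move: sQ2; rewrite (perm_mem (perm_to_rem sQ')) inE (negbTE Q2Q').
have [||x Px xs] := IH s.
- exact: sn.
- by move=> Q2 sQ2; apply: sQ; rewrite inE sQ2 orbT.
have [Qprime PQ] := sQ Q (mem_head _ _).
have [Qx|Qx] := pselect (Q x); last first.
  by exists x => // Q2; rewrite inE => /predU1P[->|/xs].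
have [y [Py Qy ys]] : exists y, [/\ P y, ~ Q y & forall Q2, Q2 \in s -> Q2 y].
  have : forall Q2, Q2 \in s -> prime_ideal Q2 /\ ~ (Q2 `<=` Q).
    move=> Q2 sQ2; split; first by case: (sQ Q2); rewrite // inE sQ2 orbT.
    by move=> Q2Q; apply: noQ'; exists Q2.
  elim: (s) => [|Q2 s' IHs] s'Q.
    have [y Py Qy] : exists2 y, P y & ~ Q y.
      apply: contrapT => noy; apply: PQ => y Py; apply: contrapT => Qy.
      by apply: noy; exists y.
    by exists y.
  have [|y [Py Qy ys]] := IHs.
    by move=> Q3 sQ3; apply: s'Q; rewrite inE sQ3 orbT.
  have [Q2prime Q2Q] := s'Q Q2 (mem_head _ _).
  have [z Q2z Qz] : exists2 z, Q2 z & ~ Q z.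
    apply: contrapT => noz; apply: Q2Q => z Q2z; apply: contrapT => Qz.
    by apply: noz; exists z.
  exists (z * y); split; first exact: idealM.
    by case/(prime_idealP Qprime).
  move=> Q3; rewrite inE => /predU1P[->|sQ3].
    by apply: idealMl => //; case: Q2prime.
  apply: idealM; last exact: ys.
  by have [[]] := s'Q Q3 (mem_behead (s := Q2 :: s') sQ3).
have sQP := prime_ideal_submodule Qprime.
exists (x + y); first exact: (submoduleD (V := R^o)).
move=> Q2; rewrite inE => /predU1P[->|sQ2].
  move=> Qxy; apply: Qy; rewrite -[y](addrK x) [y + x]addrC.
  exact: (submoduleB (V := R^o)).
have [[sQ2' _ _] _] : prime_ideal Q2 /\ ~ (P `<=` Q2) by apply: sQ;
  rewrite inE sQ2 orbT.
move=> Q2xy; apply: (xs Q2 sQ2); rewrite -[x](addrK y).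
by apply: (submoduleB (V := R^o)) => //; apply: ys.
Qed.

End Primes.

Section SystemOfParameters.
Variables (R : comNzRingType) (m : set R).
Hypothesis m_local : local_ring m.

Lemma local_prime : prime_ideal m.
Proof.
apply: prime_ideal_intro; [exact: local_ideal|exact: local_notin1|].
move=> a b mab; have [ma|/(local_unit m_local)[s sa]] := pselect (m a);
  first by left.
right; rewrite -[b]mul1r -sa -mulrA; apply: idealM => //; exact: local_ideal.
Qed.

(** An ideal maximal among those above [I] that miss every power of [r] is prime. *)
Lemma power_in_ideal (I : set R) r : ideal I ->
  (forall Q, prime_ideal Q -> I `<=` Q -> Q r) -> exists k, I (r ^+ k).
Proof.
move=> sI primes_r; apply: contrapT => nok.
have [||J [sJ IJ Jr] Jmax] := noetherian_max
  (F := fun J : set R^o => [/\ ideal J, I `<=` J & forall k, ~ J (r ^+ k)])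
  (local_noetherian m_local).
- by exists I; split=> // k Ik; apply: nok; exists k.
- by move=> J [].
have big a : ~ J a -> exists k, adjoin J a (r ^+ k).
  move=> Ja; apply: contrapT => noa; apply: Ja; rewrite -(Jmax (adjoin J a)).
  - exact: mem_adjoin.
  - split; first exact: adjoin_ideal.
      by apply: subset_trans IJ _; apply: adjoin_sub.
    by move=> k Jk; apply: noa; exists k.
  - exact: adjoin_sub.
have Jprime : prime_ideal J.
  apply: prime_ideal_intro => //; first by move=> J1; apply: (Jr 0%N);
    rewrite expr0.
  move=> a b Jab; have [Ja|/big[k rk]] := pselect (J a); first by left.
  have [Jb|/big[l rl]] := pselect (J b); first by right.
  by case: (Jr (k + l)%N); rewrite exprD; apply: adjoinM Jab rk rl.
by apply: (Jr 1%N); rewrite expr1; apply: primes_r.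
Qed.

Variables (d : nat) (P : nat -> set R).
Hypothesis P_prime : forall i, (i <= d)%N -> prime_ideal (P i).
Hypothesis P_chain : forall i, (i < d)%N -> P i `<` P i.+1.

(** The last clause says in elementary terms that every prime containing the first [e] parameters
    has height at least [e]. *)
Lemma exists_avoiding_chain e : (e <= d)%N -> exists x : nat -> R,
  (forall j, (j < e)%N -> ~ P j (x j) /\ P j.+1 (x j)) /\
  forall Q, prime_ideal Q -> (forall j, (j < e)%N -> Q (x j)) ->
    exists C : nat -> set R, [/\ forall i, (i <= e)%N -> prime_ideal (C i),
      forall i, (i < e)%N -> C i `<` C i.+1 & C e = Q].
Proof.
elim: e => [|e IH] ed.
  by exists (fun=> 0); split=> // Q Qprime _; exists (fun=> Q); split.
have [x [xP xtop]] := IH (ltnW ed).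
pose I : set R := gen_ideal (fun j : 'I_e => x j).
have sI : ideal I by apply: gen_ideal_ideal.
have Imin Q : ideal Q -> (forall j, (j < e)%N -> Q (x j)) -> I `<=` Q.
  move=> sQ Qx _ [c ->]; apply: submodule_sum => // j _.
  by apply: submoduleZ => //; apply: Qx.
have xI j : (j < e)%N -> I (x j).
  by move=> je; apply: (mem_gen_ideal (fun j : 'I_e => x j) (Ordinal je)).
have [s [sP smin]] := finitely_many_primes (local_noetherian m_local) sI.
have [Pe Pe1] := (P_prime (ltnW ed), P_prime ed).
(* [y] must avoid [P e], and also the listed primes over the previous parameters, except those
   containing [P e.+1], which no element of [P e.+1] can avoid. *)
have [y Py ys] : exists2 y, P e.+1 y &
    forall Q, Q \in P e :: [seq Q <- s | ~~ `[< P e.+1 `<=` Q >]] -> ~ Q y.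
  apply: prime_avoidance => [|Q]; first by case: Pe1.
  rewrite inE => /predU1P[->|].
    by split=> //; case: (P_chain ed).
  by rewrite mem_filter => /andP[/asboolPn PQ /sP[]].
exists (fun j => if (j < e)%N then x j else y); split=> [j|Q Qprime Qx].
  rewrite ltnS; case: ltnP => [je _|ej je]; first exact: xP.
  have -> : j = e by apply/eqP; rewrite eqn_leq je.
  by split=> //; apply: ys; rewrite mem_head.
have sQ := prime_ideal_submodule Qprime.
have [Q' sQ' Q'Q] : exists2 Q', Q' \in s & Q' `<=` Q.
  apply: smin => //; apply: Imin => // j je.
  by have := Qx j (ltnW je); rewrite je.
have Qy : Q y by have := Qx e (ltnSn e); rewrite ltnn.
have [Q'prime IQ'] := sP Q' sQ'.
have ext (C : nat -> set R) : (forall i, (i <= e)%N -> prime_ideal (C i)) ->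
    (forall i, (i < e)%N -> C i `<` C i.+1) -> C e `<` Q ->
    exists C : nat -> set R, [/\ forall i, (i <= e.+1)%N -> prime_ideal (C i),
      forall i, (i < e.+1)%N -> C i `<` C i.+1 & C e.+1 = Q].
  move=> Cprime Cchain CQ; exists (fun i => if (i <= e)%N then C i else Q);
    split.
  - by move=> i _; case: ifP => // /Cprime.
  - move=> i; rewrite ltnS => ie; rewrite ie; case: ltnP => [/Cchain//|ei].
    by have -> : i = e by apply/eqP; rewrite eqn_leq ie.
  - by rewrite ltnn.
(* In the first case the given chain up to [P e] continues to [Q]. In the second [y] is not in [Q'],
   so the inductive chain ending in [Q'] continues to [Q]. *)
have [PQ'|PQ'] := pselect (P e.+1 `<=` Q').
  apply: (ext P) => [i ie|i ie|].
  - by apply: P_prime; apply: leq_trans ie (ltnW ed).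
  - by apply: P_chain; apply: ltn_trans ie ed.
  - exact: proper_sub_trans (P_chain ed) (subset_trans PQ' Q'Q).
have [C [Cprime Cchain CQ']] := xtop Q' Q'prime (fun j je => IQ' _ (xI j je)).
apply: (ext C) => //; rewrite CQ'; split=> // QQ'.
apply: (ys Q'); last exact: QQ'.
by rewrite inE mem_filter sQ' andbT; apply/orP; right; apply/asboolPn.
Qed.

(** A prime containing all the parameters ends a chain of length [d]; were it not [m], appending [m]
    would exceed the dimension. So [m] is the only prime above them. *)
Lemma exists_sop : ring_krull_dim R d -> exists x : 'I_d -> R,
  is_sop m x /\ forall j : 'I_d, ~ P j (x j) /\ P j.+1 (x j).
Proof.
move=> Rdim; have [x [xP xtop]] := exists_avoiding_chain (leqnn d).
exists (fun j => x j); split=> [|j]; last exact: xP.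
split=> // [j|r mr].
  have [_ Px] := xP j (ltn_ord j); move: Px; apply: proper_sub_local => //.
    by case: (P_prime (ltn_ord j)).
  exact/prime_ideal1/P_prime.
apply: power_in_ideal => [|Q Qprime xQ]; first exact: gen_ideal_ideal.
have [|C [Cprime Cchain CQ]] := xtop Q Qprime.
  move=> j jd; apply: xQ.
  exact: (mem_gen_ideal (fun j : 'I_d => x j) (Ordinal jd)).
have Qm : Q `<=` m.
  by apply: proper_sub_local => //; [case: Qprime|exact: prime_ideal1].
have [->//|Qltm] := sub_proper_or_eq Qm.
case: Rdim => _ /(_ d.+1 (fun i => if (i <= d)%N then C i else m)).
rewrite ltnn => absurd; suff : false by []; apply: absurd.
split=> i.
  have Iprime : prime_ideal (if (i <= d)%N then C i else m).
    by case: ifP => [/Cprime//|_]; exact: local_prime.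
  split=> // _ ->; exact: (submodule0 (prime_ideal_submodule Iprime)).
rewrite ltnS => id; rewrite id; case: ltnP => [/Cchain//|di].
have -> : i = d by apply/eqP; rewrite eqn_leq id.
by rewrite CQ.
Qed.

End SystemOfParameters.

(** * Frobenius pushforward *)

Section FinGen.
Variables (R : comNzRingType).

(** A form of finite generation without coefficients, convenient under linear maps and restriction
    of scalars. *)
Lemma fin_gen_minP (V : lmodType R) : fin_gen V <->
  exists s : seq V, forall N, submodule N -> (forall e, e \in s -> N e) -> N =
    setT.
Proof.
split=> [/fin_genP[s sT]|[s smin]].
  by exists s => N sN /(span_sub sN); rewrite sT => TN; apply/seteqP.
by apply/fin_genP; exists s; apply: smin;
  [exact: submodule_span|exact: mem_span].
Qed.

Lemma fin_gen_surj (V W : lmodType R) (f : V -> W) : linear f ->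
  (forall w, exists v, f v = w) -> fin_gen V -> fin_gen W.
Proof.
move=> f_lin f_surj /fin_gen_minP[s smin]; apply/fin_gen_minP; exists (map f s).
move=> N sN Ns; apply/seteqP; split=> // w _; have [v <-] := f_surj w.
have : (setT : set V) v by [].
rewrite -(smin _ (submodule_preimage f_lin sN)) // => e se.
by apply: Ns; apply: map_f.
Qed.

Lemma generated_by_nu (V : lmodType R) : fin_gen V -> generated_by V (nu V).
Proof.
move=> [n Vn]; rewrite /nu; case: pselect => [h|[]].
  by case: ex_minnP => k /asboolP.
by exists n; apply/asboolP.
Qed.

(** Each generator adds a quotient of R / J. *)
Lemma len_le_span (V : lmodType R) (J : set R^o) (N : set V) (s : seq V) C :
  submodule J -> submodule N -> (forall a v, J a -> N (a *: v)) ->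
  len_le J setT C -> len_le N (addset (span s) N) (size s * C).
Proof.
move=> sJ sN JN JC; elim: s => [|e s IH] /=.
  have -> : addset [set 0] N = N; last exact: len_le_id.
  apply/seteqP; split; last by apply: addsetr; exact: submodule_set0.
  by apply: addset_sub => // _ ->; apply: submodule0.
have [ss ses] := (submodule_span s, submodule_span (e :: s)).
have sD := submodule_addset ss sN.
rewrite mulSn addnC; apply: (@len_leD _ _ _ (addset (span s) N)) => //.
- exact: submodule_addset.
- exact: addsetr.
- apply: addset_sub; [exact: submodule_addset| |exact: addsetr].
  by apply: subset_trans (addsetl sN); exact: span_cons.
have phi_lin : linear (fun a : R^o => a *: e).
  by move=> a b c; rewrite scalerDl -scalerA.
apply: (len_le_surj phi_lin _ _ _ _ JC) => //; first exact: submoduleT.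
  by move=> a Ja; apply: addsetr => //; apply: JN.
move=> w [u [a sa] Nwu]; exists a => //; exists (u - a *: e) => //.
by rewrite opprB addrA subrK.
Qed.

Lemma len_le_nu (V : lmodType R) (J : set R^o) (N : set V) C :
  fin_gen V -> submodule J -> submodule N -> (forall a v, J a -> N (a *: v)) ->
  len_le J setT C -> len_le N setT (nu V * C).
Proof.
move=> /generated_by_nu[e eT] sJ sN JN JC;
  have [s sn es] := lin_span_span_size e.
have := @len_le_span _ _ _ s _ sJ sN JN JC; rewrite sn -es eT.
by have -> : addset setT N = setT by apply/seteqP; split=> // v _;
  apply: addsetl.
Qed.

(** H_0 is V / x V, generated by [nu V] elements each killed by the ideal (x). *)
Lemma hlen_le_nu (V : lmodType R) d (x : 'I_d -> R) C : fin_gen V ->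
  len_le (gen_ideal x : set R^o) setT C ->
  hlen_le x 0 (setT : set V) [set 0] (nu V * C).
Proof.
move=> Vfg xC; have [sT s0] := (@submoduleT _ V, @submodule_set0 _ V).
have sB := submodule_kbound x 0 sT s0.
pose single (K : {set 'I_d}) (v : V) : {ffun {set 'I_d} -> V} :=
  [ffun J : {set 'I_d} => if J == K then v else 0].
have single_lin K : linear (single K).
  move=> a u v; apply/ffunP => J; rewrite !ffunE; case: eqP => // _.
  by rewrite scaler0 addr0.
have sJ : submodule (gen_ideal x : set R^o) by apply: gen_ideal_ideal.
have [s0lin sB'] := (single_lin finset.set0, submodule_preimage (single_lin
  finset.set0) sB).
have zero_mem a v : gen_ideal x a -> kbound x 0 setT [set 0] (single
  finset.set0 (a *: v)).
  move=> [c ->]; rewrite scaler_suml.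
  rewrite (big_morph _ (linear_mapD s0lin) (linear_map0 s0lin)).
  apply: submodule_sum => // k _; rewrite -[c k *: _]/(c k * x k) mulrC.
  (* The value x_k c_k v at the empty set is the boundary of c_k v placed at {k}. *)
  pose g := single [set k]%SET (c k *: v).
  have -> : single finset.set0 ((x k * c k) *: v) = koszul_d x g.
    apply/ffunP => J; rewrite !ffunE; have [->|J0] := eqVneq.
      rewrite (bigD1 k) ?inE //= finset.setU0 ffunE eqxx -scalerA.
      rewrite big1 ?addr0 => [|j /andP[_ jk]].
        by congr (_ *: _); rewrite eq_card0 ?mul1r // => j; rewrite !inE.
      rewrite finset.setU0 ffunE (inj_eq finset.set1_inj) (negbTE jk).
      by rewrite scaler0.
    rewrite big1 // => j jJ; rewrite ffunE; case: eqP => [jJk|];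
      last by rewrite scaler0.
    have := cardsU1 j J; rewrite jJk cards1 jJ => -[] /esym/eqP.
    by rewrite cards_eq0 (negbTE J0).
  apply: kbound_d => //; split=> // J Jk; rewrite ffunE.
  by case: eqP => // JK; rewrite JK cards1 in Jk.
apply: (len_le_surj s0lin _ _ _ _ (len_le_nu Vfg sJ sB' zero_mem xC)) => //.
move=> f [[f0 _] _]; exists (f finset.set0) => //.
have -> : single finset.set0 (f finset.set0) = f.
  apply/ffunP => J; rewrite ffunE; case: eqVneq => [->//|J0].
  by rewrite f0 // cards_eq0.
by rewrite subrr; apply: submodule0.
Qed.

End FinGen.

Section FrobeniusTransfer.
Variables (R : comNzRingType) (p : nat) (chR : p \in [pchar R]).

Lemma submodule_frob n (V : lmodType R) (N : set V) :
  submodule N -> submodule (N : set (frob_push chR n V : lmodType R)).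
Proof.
move=> sN; apply/submoduleP; split; first exact: (submodule0 sN).
move=> a u v Nu Nv; rewrite frob_scaleE.
exact: (submoduleD sN (submoduleZ _ sN Nu) Nv).
Qed.

Let frobm n (V : lmodType R) : lmodType R := frob_push chR n V.

(** [F^(n+1)_* M] is [F^n_* M] restricted once more along Frobenius, so it is generated by the
    products of generators of [F_* R] with generators of [F^n_* M]. *)
Lemma fin_gen_frob n (M : lmodType R) : F_finite chR -> fin_gen M ->
  fin_gen (frobm n M).
Proof.
move=> /fin_gen_minP[es esmin]; elim: n => [|n IH] Mfg.
  apply: (@fin_gen_surj _ M (frobm 0 M) id) => [a u v|w|//]; last by exists w.
  by rewrite frob_scaleE expn0 expr1.
have [t tmin] := (fin_gen_minP _).1 (IH Mfg).
apply/fin_gen_minP;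
  exists [seq ((e : R) *: (u : frobm n M) : frobm n M) | e <- es, u <- t].
move=> N sN Nt.
pose T : set (frobm n M) := [set u | forall r : R, N (r *: u : frobm n M)].
have sT : submodule T.
  apply/submoduleP; split=> [r|a u v Tu Tv r].
    by rewrite scaler0; apply: (submodule0 sN).
  by rewrite scalerDr scalerA; apply: (submoduleD sN).
have : T = setT; last first.
  by move=> TT; apply/seteqP; split=> // v _;
    rewrite -[v](scale1r (v : frobm n M)); have : T v by rewrite TT.
apply: tmin => // u tu r.
pose S : set (frobm 1 R^o) := [set r : R | N (r *: (u : frobm n M) : frobm n
  M)].
have sS : submodule S.
  apply/submoduleP; split; first by rewrite /S /= scale0r;
    apply: (submodule0 sN).
  move=> a b c Sb Sc; rewrite /S /= scalerDl; apply: (submoduleD sN) => //.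
  suff -> : ((a *: b : frobm 1 R^o) : R) *: (u : frobm n M) =
      a *: ((b : R) *: (u : frobm n M) : frobm n.+1 M) :> M.
    exact: (submoduleZ a sN Sb).
  rewrite !frob_scaleE -[a ^+ (p ^ 1) *: _]/(a ^+ (p ^ 1) * b) exprMn -exprM
    -expnD add1n.
  by rewrite scalerA.
suff ST : S = setT by have : S r by rewrite ST.
by apply: esmin => // e ese; apply: Nt; apply: allpairs_f.
Qed.

Variables (m : set R).
Hypothesis m_local : local_ring m.

Section Transfer.
Variables (n a : nat) (V : lmodType R).
Implicit Types L N : set V.

Let cyc_map (v : V) (r : frobm n R^o) : frobm n V := (r : R) *: v.

Let cyc_map_linear v : linear (cyc_map v).
Proof.
move=> b r s; rewrite /cyc_map !frob_scaleE scalerDl; congr (_ + _).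
by rewrite scalerA.
Qed.

(** A simple factor is a copy of the residue field K, and its restriction of scalars is a quotient
    of [F^n_* R] by [m], that is, [F^n_* K]. *)
Lemma len_le_frob L N l : len_le (m : set (frobm n R^o)) setT a ->
  submodule L -> submodule N -> L `<=` N -> len_le L N l ->
  len_le (L : set (frobm n V)) N (l * a).
Proof.
move=> ma sL; elim: l N => [|l IH] N sN LN Nl.
  have [<-|LltN] := sub_proper_or_eq LN; first exact: len_le_id.
  by case: Nl; apply: len_ge1.
have [[C [sC LC CN]]|Nl1] := pselect (len_ge L N l.+1); last first.
  by apply: len_le_leq (IH N sN LN Nl1); rewrite leq_mul2r leqnSn orbT.
have CsubN := properW CN.
rewrite mulSn addnC; apply: (@len_leD _ _ _ (C : set (frobm n V))) => //;
  try exact: submodule_frob.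
- exact: len_ge_sub LC.
- apply: IH => //; first exact: len_ge_sub LC.
  by move=> LCl; apply: Nl; exists C.
have [v Nv Cv] : exists2 v, N v & ~ C v.
  case: CN => _ NC; apply: contrapT => nov; apply: NC => v Nv.
  by apply: contrapT => Cv; apply: nov; exists v.
have NE w : N w -> addset C (cyclic_span v) w.
  move=> Nw; apply: contrapT => Dw; apply: Nl.
  have sD := submodule_addset sC (submodule_cyclic v).
  exists (addset C (cyclic_span v)); split=> //; last first.
    split; last by move=> /(_ w Nw).
    by apply: addset_sub => //; apply: cyclic_span_sub.
  exists C; split=> //; split; first exact: addsetl (submodule_cyclic v).
  move=> /(_ v) DC; apply/Cv/DC/addsetr => //; exact: cyclic_span_id.
apply: (len_le_surj (cyc_map_linear v) _ _ _ _ ma) => //;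
  first exact: submoduleT.
(* If [r] did not carry [v] into [C], then C + R r v would lie strictly between [C] and [N]: it
   misses [v] because 1 - s r is a unit, as in Nakayama's lemma. *)
- move=> r mr; apply: contrapT => Crv; apply: Nl.
  have sD := submodule_addset sC (submodule_cyclic (r *: v)).
  exists (addset C (cyclic_span (r *: v))); split=> //; last split.
  - exists C; split=> //; split; first exact: addsetl (submodule_cyclic _).
    move=> /(_ (r *: v)) DC; apply/Crv/DC/addsetr => //; exact: cyclic_span_id.
  - by apply: addset_sub => //; apply: cyclic_span_sub => //; apply: submoduleZ.
  move=> /(_ v Nv)[c Cc [s vc]]; apply: Cv.
  have [msr|/(local_unit m_local)[t tE]] := pselect (m (1 - s * r)).
    case: (local_notin1 m_local); rewrite -[1](subrK (s * r)).
    apply: (submoduleD (V := R^o) (local_ideal m_local)) => //.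
    exact: (submoduleZ (V := R^o) s (local_ideal m_local) mr).
  rewrite -[v]scale1r -tE -scalerA; apply: submoduleZ => //.
  by rewrite scalerBl scale1r -scalerA -vc subKr.
move=> w /NE[c Cc [r wc]]; exists r => //.
by rewrite /cyc_map -wc subKr.
Qed.

(** For [v] in [N] outside [C], only elements of [m] carry [v] into [C], so each strict step
    contributes at least the length of [F^n_* K]. *)
Lemma len_ge_frob L N l : len_ge (m : set (frobm n R^o)) setT a ->
  submodule L -> submodule N -> len_ge L N l ->
  len_ge (L : set (frobm n V)) N (l * a).
Proof.
move=> ma sL; elim: l N => [//|l IH] N sN [C [sC LC CN]].
rewrite mulSn addnC; apply: (len_geD (IH C sC LC)).
have [v Nv Cv] : exists2 v, N v & ~ C v.
  case: CN => _ NC; apply: contrapT => nov; apply: NC => v Nv.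
  by apply: contrapT => Cv; apply: nov; exists v.
apply: (len_ge_inj (cyc_map_linear v) _ _ _ _ _ _ ma).
- exact: submoduleT.
- exact: submodule_frob.
- exact: submodule_frob.
- by move=> _ [r _ <-]; apply: submoduleZ.
- exact: properW.
move=> r _ Crv; apply: contrapT => /(local_unit m_local)[s sr]; apply: Cv.
by rewrite -[v]scale1r -sr -scalerA; apply: submoduleZ.
Qed.

End Transfer.

(** An element [r] of [m] acts on [F^n_* R] through its power r ^ q, whose multiples lie in [m]; so
    [m] kills the finitely generated module [F^n_* K]. *)
Lemma frob_residue_length n : F_finite chR -> exists a,
  len_ge (m : set (frobm n R^o)) setT a /\ len_le (m : set (frobm n R^o)) setT
    a.
Proof.
move=> Ffin; have sm := submodule_frob n (local_ideal m_local).
have Rfg : fin_gen (R^o : lmodType R).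
  by exists 1%N, (fun=> 1); apply/seteqP; split=> // r _; exists (fun=> r);
    rewrite big_ord1 [_ *: _]mulr1.
have noeth : noetherian_mod (frobm n R^o).
  by apply: fin_gen_noetherian; [case: m_local|exact: fin_gen_frob].
have p0 : (0 < p)%N by apply/prime_gt0/(pcharf_prime chR).
have q0 : (0 < p ^ n)%N by rewrite expn_gt0 p0.
have [//|r mr|C mC] := finite_length m_local noeth sm (submoduleT _).
  exists 1%N => v _; rewrite expr1 frob_scaleE -(prednK q0) exprS -scalerA.
  rewrite -[_ *: _]/(r * _) mulrC.
  exact: (submoduleZ (V := R^o) _ (local_ideal m_local) mr).
by have [//|a [_ ma am]] := len_exact _ mC; exists a.
Qed.

Lemma koszul_d_frob n (M : lmodType R) d (x : 'I_d -> R) (f : {ffun {set 'I_d}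
  -> M}) :
  koszul_d x (f : {ffun {set 'I_d} -> frobm n M}) =
  koszul_d (fun j => x j ^+ (p ^ n)) f :> {ffun {set 'I_d} -> M}.
Proof.
(* The signs of the differential must survive the q-th power; additivity of Frobenius on -1 + 1
   gives this for every [p], including 2. *)
have N1q : (-1 : R) ^+ (p ^ n) = -1.
  have := frobD chR n (-1) 1; rewrite addNr expr1n expr0n.
  have p0 : (0 < p)%N by apply/prime_gt0/(pcharf_prime chR).
  rewrite expn_eq0 (negbTE (lt0n_neq0 p0)) /= => /eqP; rewrite eq_sym addr_eq0.
  by move/eqP.
apply/ffunP => J; rewrite !ffunE; apply: eq_bigr => k _.
by rewrite frob_scaleE exprMn exprAC N1q.
Qed.

Lemma kcyc_frob n (M : lmodType R) d (x : 'I_d -> R) i :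
  kcyc x i (setT : set (frobm n M)) [set 0] =
  kcyc (fun j => x j ^+ (p ^ n)) i (setT : set M) [set 0].
Proof.
by apply/seteqP; split=> f [Nf Lf]; split=> // J; have := Lf J;
  rewrite koszul_d_frob.
Qed.

Lemma kbound_frob n (M : lmodType R) d (x : 'I_d -> R) i :
  kbound x i (setT : set (frobm n M)) [set 0] =
  kbound (fun j => x j ^+ (p ^ n)) i (setT : set M) [set 0].
Proof.
apply/seteqP; split=> f [_ [g Ng <-] Lfg].
  exists (@koszul_d R d (fun j => x j ^+ (p ^ n)) M g); first by exists g;
    first exact: Ng.
  by rewrite -koszul_d_frob; exact: Lfg.
exists (@koszul_d R d x (frobm n M) g); first by exists g; first exact: Ng.
by rewrite koszul_d_frob; exact: Lfg.
Qed.

Lemma hlen_le_frob n (M : lmodType R) d (x : 'I_d -> R) i k a :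
  len_le (m : set (frobm n R^o)) setT a ->
  hlen_le (fun j => x j ^+ (p ^ n)) i (setT : set M) [set 0] k ->
  hlen_le x i (setT : set (frobm n M)) [set 0] (k * a).
Proof.
have [sT s0] := (@submoduleT _ M, @submodule_set0 _ M).
move=> ma /(len_le_frob ma (submodule_kbound _ i sT s0) (submodule_kcyc _ i sT
  s0)).
move=> /(_ (kbound_kcyc sT s0 (@subsetT _ _))).
(* Chains of the pushforward and the pushforward of the chains are the same module; [idf] is the
   identity between the two types. *)
pose idf (f : frobm n {ffun {set 'I_d} -> M}) : {ffun {set 'I_d} -> frobm n M}
  := f.
have idf_lin : linear idf by [].
rewrite /hlen_le kbound_frob kcyc_frob.
apply: (len_le_surj idf_lin).
- exact: submodule_frob (submodule_kcyc _ i sT s0).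
- exact: kbound_kcyc.
- by [].
move=> f Zf; exists f => //; rewrite subrr -kbound_frob; apply: submodule0.
apply: submodule_kbound; [exact: submoduleT|exact: submodule_set0].
Qed.

Lemma hlen_ge_frob n (M : lmodType R) d (x : 'I_d -> R) i k a :
  len_ge (m : set (frobm n R^o)) setT a ->
  hlen_ge (fun j => x j ^+ (p ^ n)) i (setT : set M) [set 0] k ->
  hlen_ge x i (setT : set (frobm n M)) [set 0] (k * a).
Proof.
have [sT s0] := (@submoduleT _ M, @submodule_set0 _ M).
move=> ma /(len_ge_frob ma (submodule_kbound _ i sT s0) (submodule_kcyc _ i sT
  s0)).
pose idf (f : frobm n {ffun {set 'I_d} -> M}) : {ffun {set 'I_d} -> frobm n M}
  := f.
have idf_lin : linear idf by [].
have [sTn s0n] := (@submoduleT _ (frobm n M), @submodule_set0 _ (frobm n M)).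
rewrite /hlen_ge -kbound_frob -kcyc_frob.
apply: (len_ge_inj idf_lin).
- rewrite kcyc_frob; exact: submodule_frob (submodule_kcyc _ i sT s0).
- exact: submodule_kbound.
- exact: submodule_kcyc.
- by move=> _ [f Zf <-].
- exact: kbound_kcyc.
- by [].
Qed.

End FrobeniusTransfer.

(** * Module-finite algebras *)

Section IntegralContraction.
Variables (R : comNzRingType) (S : comAlgType R).

Definition contraction (Q : set S) : set R := [set r | Q (r%:A)].

Lemma contraction_prime (Q : set S) : prime_ideal Q -> prime_ideal (contraction
  Q).
Proof.
move=> Qprime; have sQ := prime_ideal_submodule Qprime.
apply: prime_ideal_intro => [||a b].
- apply/submoduleP; split; first by rewrite /contraction /= scale0r;
  apply: (submodule0 sQ).
  move=> a b c Qb Qc; rewrite /contraction /= scalerDl.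
  apply: (submoduleD sQ) => //; rewrite -[a *: b]/(a * b) -scalerA -mulr_algl.
  exact: (submoduleZ (V := S^o)).
- by rewrite /contraction /= scale1r; apply: prime_ideal1.
by rewrite /contraction /= -scalerA -mulr_algl; apply: prime_idealP.
Qed.

(** The constant term of a monic relation modulo [Q] lies in [Q'], hence in [Q] by the equality of
    contractions; as [s] is not in [Q], a factor [s] can be cancelled, lowering the degree. *)
Lemma not_monic_mod (Q Q' : set S) (s : S) k (c : nat -> R) :
  prime_ideal Q -> prime_ideal Q' -> Q `<=` Q' ->
  contraction Q' `<=` contraction Q -> Q' s -> ~ Q s ->
  ~ Q (\sum_(j < k) c j *: s ^+ j + s ^+ k).
Proof.
move=> Qprime Q'prime QQ' Q'Q Q's Qs.
have [sQ sQ'] := (prime_ideal_submodule Qprime, prime_ideal_submodule Q'prime).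
elim: k c => [|k IH] c; first by rewrite big_ord0 add0r expr0;
  apply: prime_ideal1.
rewrite big_ord_recl /= expr0.
have -> : \sum_(j < k) c (bump 0 j) *: s ^+ bump 0 j =
    s * \sum_(j < k) c j.+1 *: s ^+ j.
  by rewrite mulr_sumr; apply: eq_bigr => j _; rewrite -scalerAr -exprS.
rewrite exprS -addrA -mulrDr; set t := _ + s ^+ k => Qct.
have Qst : Q' (s * t) by exact: (idealMl t sQ' Q's).
have Qc : Q ((c 0%N)%:A).
  by apply: Q'Q; rewrite /contraction /= -[_%:A](addrK (s * t));
    apply: (submoduleB (V := S^o)) => //; apply: QQ'.
have [//|] : Q s \/ Q t; last exact: (IH (fun j => c j.+1)).
apply: (prime_idealP Qprime);
  rewrite -[s * t](addrK (c 0%N)%:A) [s * t + _]addrC.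
exact: (submoduleB (V := S^o)).
Qed.

(** Incomparability for integral extensions. The spans of 1, s, ..., s ^ (k - 1) become stationary,
    which gives a monic equation for [s]. *)
Lemma contraction_proper (Q Q' : set S) : noetherian_mod S ->
  prime_ideal Q -> prime_ideal Q' -> Q `<` Q' ->
  contraction Q `<` contraction Q'.
Proof.
move=> noeth Qprime Q'prime [QQ' Q'Q]; split=> [r|contr]; first exact: QQ'.
apply: Q'Q => s Q's; apply: contrapT => Qs.
pose C k : set S := [set v | exists c : nat -> R, v = \sum_(j < k) c j *: s ^+
  j].
have sC k : submodule (C k).
  apply/submoduleP; split.
    by exists (fun=> 0); rewrite big1 // => j _; rewrite scale0r.
  move=> a _ _ [b ->] [c ->]; exists (fun j => a * b j + c j).
  rewrite scaler_sumr -big_split; apply: eq_bigr => j _.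
  by rewrite /= scalerDl scalerA.
have CS k : C k `<=` C k.+1.
  move=> _ [c ->]; exists (fun j => if (j < k)%N then c j else 0).
  rewrite big_ord_recr /= ltnn scale0r addr0.
  by apply: eq_bigr => j _; rewrite ltn_ord.
have [k Ck] := noetherian_stable noeth sC CS.
have [c sk] : C k (s ^+ k).
  rewrite -Ck; exists (fun j => (j == k)%:R).
  rewrite big_ord_recr /= eqxx scale1r big1 ?add0r // => j _.
  by rewrite ltn_eqF // scale0r.
case: (@not_monic_mod _ _ s k (fun j => - c j) Qprime Q'prime QQ' contr Q's Qs).
under eq_bigr do rewrite scaleNr.
by rewrite sumrN -sk addNr; apply: (submodule0 (prime_ideal_submodule Qprime)).
Qed.

(** This turns a chain of primes of [S] into one above the annihilator of [S], from which the module
    case starts. *)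
Lemma prime_chain_contraction d (Q : nat -> set S) : noetherian_mod S ->
  prime_chain [set 0] d Q ->
  prime_chain (annihilator S) d (fun i => contraction (Q i)).
Proof.
move=> noeth [Qprime Qchain]; split=> i id.
  have [Qi _] := Qprime i id; split; first exact: contraction_prime.
  move=> a /(_ 1) a0; rewrite /contraction /= a0.
  exact: (submodule0 (prime_ideal_submodule Qi)).
apply: contraction_proper => //; last exact: Qchain.
  by case: (Qprime i (ltnW id)).
by case: (Qprime i.+1 id).
Qed.

End IntegralContraction.

(** * The limit estimate *)

Section FrobeniusLimCM.
Variables (R : comNzRingType) (m : set R) (p d : nat) (chR : p \in [pchar R]).
Hypotheses (m_local : local_ring m) (Ffin : F_finite chR).
Hypothesis Rdim : ring_krull_dim R d.

(** A chain of length [d] above the annihilator is what a module of dimension [d] and a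
    module-finite algebra of dimension [d] both supply. *)
Lemma lim_CM_frob_push (M : lmodType R) (P : nat -> set R) : fin_gen M ->
  prime_chain (annihilator M) d P ->
  lim_CM m (fun n => frob_push chR n M : lmodType R).
Proof.
move=> Mfg [PprimeM Pchain]; pose F n : lmodType R := frob_push chR n M.
have Pprime i (id : (i <= d)%N) := proj1 (PprimeM i id).
have p1 : (1 < p)%N by apply/prime_gt1/(pcharf_prime chR).
split=> [n|].
  split; first exact: fin_gen_frob.
  (* If [M] were 0, then 1 would lie in its annihilator and so in [P 0]. *)
  apply: contrapT => nov; apply: (prime_ideal1 (Pprime 0%N (leq0n _))).
  apply: (proj2 (PprimeM 0%N (leq0n _))) => v; rewrite scale1r.
  by apply: contrapT => v0; apply: nov; exists v.
have [x [xsop Px]] := exists_sop m_local Pprime Pchain Rdim.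
exists d, x; split=> // i i0; have [_ _ xm] := xsop.
have noeth : noetherian_mod M by apply: fin_gen_noetherian => //; case: m_local.
have [sT s0] := (@submoduleT _ M, @submodule_set0 _ M).
have Mx : is_sop_on m x ([set 0] : set M) setT.
  move=> r /xm[k xk]; exists k, (r ^+ k); split=> // v _.
  by rewrite subrr scale0r.
have [C HC] := koszul_growth_sop m_local noeth i s0 sT (@subsetT _ _) Mx.
have [A [n0 HA]] := koszul_lower_module m_local Mfg (proj2 (PprimeM 0%N (leq0n
  _)))
  Pprime (fun i id => properW (Pchain i id)) Px xm.
have [|B xB] := finite_length m_local (local_noetherian m_local)
  (gen_ideal_ideal x) (@submoduleT _ (R^o : lmodType R)) (@subsetT _ _).
  move=> r /xm[k xk]; exists k => v _; rewrite [_ *: _]mulrC.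
  exact: (submoduleZ (V := R^o) _ (gen_ideal_ideal x)).
(* With q = p ^ n and a = a_n, q l <= q k a <= C q ^ d a <= C A k' a <= C A B nu, where [k'] is the
   lower bound for H_0 of x ^ q on [M] and [B] bounds the length of R / (x). *)
have main n : exists l, koszul_homology_length x (F n) i l /\
    ((n0 <= p ^ n)%N -> (p ^ n * l <= C * A * B * nu (F n))%N).
  have q0 : (0 < p ^ n)%N by rewrite expn_gt0 (ltnW p1).
  have [a [age ale]] := frob_residue_length m_local n Ffin.
  have [k Mk kC] := HC _ q0; rewrite i0 expn1 in kC.
  have Hk := hlen_le_frob m_local ale Mk.
  have [sTn s0n] := (@submoduleT _ (F n), @submodule_set0 _ (F n)).
  have [l [lk Hge Hle]] := len_exact (kbound_kcyc sTn s0n (@subsetT _ _)) Hk.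
  exists l; split.
    rewrite /koszul_homology_length.
    have -> : @koszul_cycles R d x (F n) i = kcyc x i setT [set 0].
      apply/seteqP; split=> [f [fi df]|f [[fi _] df]]; split=> //.
        by move=> J; rewrite df ffunE.
      by apply/ffunP => J; rewrite df ffunE.
    have -> : @koszul_boundaries R d x (F n) i = kbound x i setT [set 0].
      apply/seteqP; split=> f.
        by move=> [g gi <-]; apply: kbound_d.
      move=> [_ [g [gi _] <-] [_ fg]]; exists g => //.
      by apply/ffunP => J; have := fg J;
        rewrite ffun_addE ffun_oppE => /subr0_eq.
    by apply: len_exact_subquot => //;
      [exact: submodule_kbound|exact: submodule_kcyc].
  move=> /HA[k' Mk' k'A].
  have Hk' := hlen_ge_frob m_local age Mk'.
  have Vfg := fin_gen_frob n Ffin Mfg.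
  have := len_ge_le Hk' (hlen_le_nu Vfg xB).
  set nuM := nu _ => k'nu.
  apply: (@leq_trans (C * A * (k' * a))); last first.
    by rewrite -!mulnA !leq_mul2l [(B * _)%N]mulnC k'nu !orbT.
  apply: (@leq_trans (p ^ n * (k * a))); first by rewrite leq_mul2l lk orbT.
  rewrite !mulnA leq_mul2r; apply/orP; right; apply: leq_trans kC _.
  by rewrite -mulnA leq_mul2l k'A orbT.
have [l lP] := choice main.
exists l; split=> [n|]; first by case: (lP n).
apply/eqoP => eps eps0.
(* As n < p ^ n, taking [n] beyond [n0] and [N] puts p ^ n beyond them too, and then D / p ^ n is at
   most [eps]. *)
pose D := (C * A * B)%N; pose N := Num.bound (D%:R / eps : rat).
exists (maxn n0 N) => // n /=; rewrite geq_max => /andP[n0n Nn].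
have nq : (n < p ^ n)%N by apply: ltn_expl.
have [_ /(_ (leq_trans n0n (ltnW nq)))] := lP n; rewrite -/D;
  set nuM := nu _ => ln.
rewrite !ger0_norm ?ler0n //.
have q0 : (0 < (p ^ n)%:R :> rat) by rewrite ltr0n (leq_trans _ nq).
rewrite -(ler_pM2l q0) -natrM; apply: (@le_trans _ _ ((D * nuM)%:R)).
  by rewrite ler_nat.
rewrite natrM mulrA; apply: ler_wpM2r; first exact: ler0n.
rewrite -ler_pdivrMr //; apply: le_trans (_ : N%:R <= _).
  by apply/ltW/archi_boundP/divr_ge0; [exact: ler0n|exact: ltW].
by rewrite ler_nat (leq_trans Nn) // ltnW.
Qed.

End FrobeniusLimCM.

Theorem theorem5p4 (R : comNzRingType) (m : set R) (p d : nat)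
    (chR : p \in [pchar R]) (Rlocal : local_ring m) (Rfin : F_finite chR)
    (Rdim : ring_krull_dim R d) :
  [/\ forall M : lmodType R, fin_gen M -> mod_krull_dim M d ->
        lim_CM m (fun n => frob_push chR n M : lmodType R),
      forall S : comAlgType R, fin_gen S -> ring_krull_dim S d ->
        lim_CM_algebras m (fun n => frob_push chR n S : comAlgType R)
    & lim_CM_algebras m (fun n => frob_push chR n R^o : comAlgType R)].
Proof.
have alg (S : comAlgType R) : fin_gen S -> ring_krull_dim S d ->
    lim_CM_algebras m (fun n => frob_push chR n S : comAlgType R).
  move=> Sfg [[Q Qchain] _].
  have noeth : noetherian_mod S by apply: fin_gen_noetherian => //; case: Rlocal.
  exact: (lim_CM_frob_push Rlocal Rfin Rdim Sfg (prime_chain_contraction noeth Qchain)).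
split=> //; last first.
  apply: alg => //; exists 1%N, (fun=> 1); apply/seteqP; split=> // r _.
  by exists (fun=> r); rewrite big_ord1 [_ *: _]mulr1.
move=> M Mfg [[P Pchain] _].
exact: (lim_CM_frob_push Rlocal Rfin Rdim Mfg Pchain).
Qed.
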